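(* Let $\mathcal H$ and $\hat{\mathcal H}$ be compact self-adjoint operators with non-negative eigenvalues on a separable real Hilbert space $\mathbb H$, and let $J$ be a finite index set with spectral gap $\gamma_J>0$ (all notation as defined in the context). If $\hat\alpha_J\le1/4$, then $$\Big|\sum_{k\in J}\hat\lambda_k-\sum_{k\in J}\lambda_k-\sum_{k\in J}\langle(\hat{\mathcal H}-\mathcal H)\psi_k,\psi_k\rangle\Big|\le\Big(\frac52\gamma_J+4\theta_{\max}-4\theta_{\min}\Big)\hat\beta_J^2 .$$
   Context: $\mathbb H$ is a separable real Hilbert space with inner product $\langle\cdot,\cdot\rangle$; $\|\cdot\|_{\mathrm{op}}$ and $\|\cdot\|_{\mathrm{HS}}$ are the operator and Hilbert–Schmidt norms; $(u\otimes v)w=\langle v,w\rangle u$. $\mathcal H,\hat{\mathcal H}$ are compact self-adjoint operators on $\mathbb H$ whose eigenvalues are all non-negative. Write $\mathcal H=\sum_{k}\lambda_k\mathcal Q_k$, $\mathcal Q_k=\psi_k\otimes\psi_k$, with $\lambda_1\ge\lambda_2\ge\dots\ge0$ (repeated according to multiplicity) and orthonormal eigenvectors $\psi_k$; similarly $\hat{\mathcal H}=\sum_k\hat\lambda_k\hat{\mathcal Q}_k$, $\hat{\mathcal Q}_k=\hat\psi_k\otimes\hat\psi_k$, $\hat\lambda_1\ge\hat\lambda_2\ge\dots\ge0$. Both eigenvector systems are understood to be complete, $\sum_k\mathcal Q_k=\sum_k\hat{\mathcal Q}_k=$ identity: if the ordered sequence misses part of the kernel, an orthonormal basis of the remaining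 part of the kernel is adjoined with eigenvalue $0$, and is included in all sums over indices not in $J$. $J\subset\mathbb N$ is a finite nonempty index set with $\gamma_J:=\min_{k\in J,\ell\notin J}|\lambda_k-\lambda_\ell|>0$; $\theta_{\max}=\max_{k\in J}\lambda_k$, $\theta_{\min}=\min_{k\in J}\lambda_k$; $\mathcal P_J=\sum_{k\in J}\mathcal Q_k$. Weighted perturbation quantities: with $$|\mathcal R|_J^{1/2}=\sum_{k\notin J}\frac{\mathcal Q_k}{\sqrt{\min_{m\in J}|\lambda_k-\lambda_m|}},\qquad \mathcal T_J^{1/2}=\frac{1}{\sqrt{\gamma_J}}\mathcal P_J+|\mathcal R|_J^{1/2},$$ set $\hat\alpha_J=\|\mathcal T_J^{1/2}(\hat{\mathcal H}-\mathcal H)\mathcal T_J^{1/2}\|_{\mathrm{op}}$ and $\hat\beta_J=\gamma_J^{-1/2}\||\mathcal R|_J^{1/2}(\hat{\mathcal H}-\mathcal H)\mathcal P_J\|_{\mathrm{HS}}$. *)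

(* Defs.v *)
From HB Require Import structures.
From mathcomp Require Import all_boot all_order all_algebra finmap.
From mathcomp Require Import sesquilinear.
From mathcomp Require Import all_classical all_reals all_analysis.
From mathcomp Require Import summability.

Set Implicit Arguments.
Unset Strict Implicit.
Unset Printing Implicit Defensive.

Import Order.TTheory GRing.Theory Num.Theory.
Import numFieldNormedType.Exports.

Local Open Scope classical_set_scope.
Local Open Scope ring_scope.

(* A real Hilbert space is a complete normed module [H] over [R : realType]
   together with a positive definite symmetric form [ip] that induces its norm.
   Infinite sums are limits along [totally], i.e. along the net of finite index
   sets (unconditional summation). *)

Section Operators.
Context {R : realType} {H : completeNormedModType R}.

Definition separable : Prop := exists2 D : set H, countable D & dense D.

Definition induces_norm (ip : {dot H for idfun}) : Prop :=
  forall x : H, `|x| ^+ 2 = ip x x.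

Definition compact_operator (A : H -> H) : Prop :=
  compact (closure (A @` [set x | `|x| <= 1])).

Definition self_adjoint (ip : {dot H for idfun}) (A : H -> H) : Prop :=
  forall x y, ip (A x) y = ip x (A y).

Definition eigenvalues_ge0 (A : H -> H) : Prop :=
  forall (a : R) (x : H), x != 0 -> A x = a *: x -> 0 <= a.

Definition tensor (ip : {dot H for idfun}) (u v w : H) : H := ip v w *: u.

Definition hsum (I : choiceType) (D : set I) (u : I -> H) : H :=
  lim ((fun F : {fset I} => \sum_(i <- F | i \in D) u i) @ totally).

Definition orthonormal_basis (ip : {dot H for idfun}) (I : choiceType)
    (D : set I) (e : I -> H) : Prop :=
  (forall i j, D i -> D j -> ip (e i) (e j) = (i == j)%:R) /\
  (forall x : H,
    (fun F : {fset I} => \sum_(i <- F | i \in D) tensor ip (e i) (e i) x)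
      @ totally --> x).

(* [sup] is 0 on unbounded sets, so this is meaningful for bounded [A] only. *)
Definition op_norm (A : H -> H) : R :=
  sup [set `|A x| | x in [set x | `|x| <= 1]].

(* The Hilbert-Schmidt norm, computed in the orthonormal basis [e] indexed by
   [D]; meaningful when the sum is finite ([fine +oo = 0]). *)
Definition hs_norm (I : choiceType) (D : set I) (e : I -> H) (A : H -> H) : R :=
  Num.sqrt (fine (\esum_(i in D) (`|A (e i)| ^+ 2)%:E)).

(* A complete orthonormal system of eigenvectors of [A].  Indices [inl k] form
   the ordered sequence, with k counted from 0; it may be finite.  Indices
   [inr k] enumerate the adjoined orthonormal basis of the part of the kernel
   that the ordered sequence misses.  Data at indices outside [eidx] are
   irrelevant. *)
Record eigensystem (ip : {dot H for idfun}) (A : H -> H) := Eigensystem {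
  eidx : set (nat + nat) ;
  eigval : nat + nat -> R ;
  evec : nat + nat -> H ;
  evec_basis : orthonormal_basis ip eidx evec ;
  evec_eigen : forall i, eidx i -> A (evec i) = eigval i *: evec i ;
  eidx_initial : forall k l : nat, (k <= l)%N -> eidx (inl l) -> eidx (inl k) ;
  eigval_noninc : forall k l : nat, (k <= l)%N -> eidx (inl l) ->
    eigval (inl l) <= eigval (inl k) ;
  eigval_ge0 : forall i, eidx i -> 0 <= eigval i ;
  eigval_adjoined : forall k : nat, eidx (inr k) -> eigval (inr k) = 0
}.

End Operators.

Section SpectralBlock.
Context {R : realType} {H : completeNormedModType R} {ip : {dot H for idfun}}.
Context {A : H -> H} (S : eigensystem ip A) (J : {fset nat}).

Definition lam (k : nat) : R := eigval S (inl k).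
Definition psi (k : nat) : H := evec S (inl k).

Definition eproj (i : nat + nat) : H -> H := tensor ip (evec S i) (evec S i).

Definition outside : set (nat + nat) := eidx S `\` (inl @` [set` J]).

(* The infimum defining [gap] is attained, because [J] is finite and the ordered
   sequence is nonincreasing and nonnegative.  If [outside] is empty, the gap is
   0 ([inf set0 = 0]). *)
Definition gap : R :=
  inf [set `|lam k - eigval S i| | k in [set` J] & i in outside].

Definition theta_max : R := sup [set lam k | k in [set` J]].
Definition theta_min : R := inf [set lam k | k in [set` J]].

Definition dist_block (t : R) : R := inf [set `|t - lam m| | m in [set` J]].

Definition block_proj (x : H) : H := \sum_(k <- J) eproj (inl k) x.

Definition abs_resolvent_sqrt (x : H) : H :=
  hsum outside (fun i => (Num.sqrt (dist_block (eigval S i)))^-1 *: eproj i x).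

Definition weight_sqrt (x : H) : H :=
  (Num.sqrt gap)^-1 *: block_proj x + abs_resolvent_sqrt x.

Definition alpha (Ah : H -> H) : R :=
  op_norm (weight_sqrt \o (Ah \- A) \o weight_sqrt).

Definition beta (I : choiceType) (D : set I) (e : I -> H) (Ah : H -> H) : R :=
  (Num.sqrt gap)^-1
    * hs_norm D e (abs_resolvent_sqrt \o (Ah \- A) \o block_proj).

End SpectralBlock.

(* Main.v *)
Require Import Defs.
From HB Require Import structures.
From mathcomp Require Import all_boot all_order all_algebra finmap.
From mathcomp Require Import sesquilinear.
From mathcomp Require Import all_classical all_reals all_analysis.
From mathcomp Require Import summability.
From mathcomp Require Import ring lra.
Set Implicit Arguments.
Unset Strict Implicit.
Unset Printing Implicit Defensive.
Import Order.TTheory GRing.Theory Num.Theory.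
Import numFieldNormedType.Exports.
Local Open Scope classical_set_scope.
Local Open Scope ring_scope.

(** Write E = Ah - A, let P be the projection onto the block spanned by the
    eigenvectors psi_k with k in J, and for an eigenvector outside the block let
    g_l be the distance from its eigenvalue to the eigenvalues of the block.

    The hypothesis on alpha says that the quadratic form of E is at most 1/4 of
    the form with eigenvalues gap on the block and g_l outside it
    ([perturbation_form_le]).  For p in the block and y outside, the cross term
    2 <E p, y> is at most 2 |Rs E p|^2 + 1/2 sum_l g_l y_l^2, where Rs has
    eigenvalues g_l^(-1/2) ([cross_term_le]).  Hence Ah lies between two operators
    that are block diagonal for P ([block_form]): on the block they are
    N+ and N-, where N+- is the compression of Ah plus or minus 2 (Rs E P)^T (Rs E P),
    and outside the block they are diagonal with eigenvalues lam_l +- 3/4 g_l.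

    Moving lam_l by 3/4 g_l leaves it at distance at least gap / 4 from each
    eigenvalue of the block, on the side where it started ([tail_gap],
    [head_gap]).  The i-th eigenvalue of N+ is at least lam_(k_i) - gap / 4, and
    that of N- at most lam_(k_i) + gap / 4, where k_i is the i-th element of J
    ([compression_eig_ge], [compression_eig_le]).  So in the spectrum of the upper
    block operator nothing from beyond position k_i exceeds the i-th eigenvalue of
    N+, and dually for the lower one, and the Courant-Fischer principle gives
      nu_i <= lamhat_(k_i) <= mu_i
    for the ordered eigenvalues nu_i of N- and mu_i of N+ ([perturbed_eig_ge],
    [perturbed_eig_le]).

    Summing over i turns both sides into traces.  The trace of the compression of
    Ah is the sum of the lam_k and of the <E psi_k, psi_k>, and the correction has
    trace 2 |Rs E P|_HS^2 = 2 gap beta^2.  The quantity to be estimated is thus at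
    most 2 gap beta^2, which implies the stated bound because theta_min is at most
    theta_max.

    Infinite expansions enter only through limits: the form inequalities are
    proved for finite combinations of eigenvectors, and pass to arbitrary vectors
    because compact operators are continuous. *)

#[local] Existing Instance totally_filter.

(** * Inner products, norms and limits *)

Lemma le_cvg (R : realType) T (F : set_system T) {FF : ProperFilter F}
    (f g : T -> R) (a b : R) :
  f @ F --> a -> g @ F --> b -> (\forall t \near F, f t <= g t) -> a <= b.
Proof.
move=> fa gb fg; rewrite -subr_ge0.
apply: (@closed_cvg _ _ F _ (g \- f) [set y | 0 <= y]).
- exact: closed_ge.
- by apply: filterS fg => t /=; rewrite subr_ge0.
- exact: cvgB.
Qed.

Lemma sum_fsetD (V : zmodType) (I : choiceType) (F0 F : {fset I}) (P : pred I)
    (u : I -> V) : (F0 `<=` F)%fset ->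
  \sum_(i <- F | P i) u i
  = \sum_(i <- F0 | P i) u i + \sum_(i <- (F `\` F0)%fset | P i) u i.
Proof.
move=> F0F; rewrite -big_cat; apply: perm_big; apply: uniq_perm.
- exact: fset_uniq.
- rewrite cat_uniq !fset_uniq andbT/=; apply/hasPn => i.
  by rewrite inE => /andP[].
- move=> i; rewrite mem_cat in_fsetD; case: (boolP (i \in F0)) => //= iF0.
  exact: (fsubsetP F0F).
Qed.

Section InnerProduct.
Context {R : realType} {H : completeNormedModType R} (ip : {dot H for idfun}).

Lemma ipC (x y : H) : ip x y = ip y x.
Proof. by rewrite hermC expr0 mul1r. Qed.

Lemma ipDl (x y z : H) : ip (x + y) z = ip x z + ip y z.
Proof. exact: linearDl. Qed.

Lemma ipDr (x y z : H) : ip x (y + z) = ip x y + ip x z.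
Proof. exact: linearDr. Qed.

Lemma ipBl (x y z : H) : ip (x - y) z = ip x z - ip y z.
Proof. exact: linearBl. Qed.

Lemma ipBr (x y z : H) : ip x (y - z) = ip x y - ip x z.
Proof. exact: linearBr. Qed.

Lemma ipZl a (x y : H) : ip (a *: x) y = a * ip x y.
Proof. exact: linearZl_LR. Qed.

Lemma ipZr a (x y : H) : ip x (a *: y) = a * ip x y.
Proof. exact: linearZr_LR. Qed.

Lemma ip_suml I (r : seq I) (P : pred I) (u : I -> H) x :
  ip (\sum_(i <- r | P i) u i) x = \sum_(i <- r | P i) ip (u i) x.
Proof. exact: linear_sumlz. Qed.

Lemma ip_sumr I (r : seq I) (P : pred I) (u : I -> H) x :
  ip x (\sum_(i <- r | P i) u i) = \sum_(i <- r | P i) ip x (u i).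
Proof. exact: linear_sumr. Qed.

Lemma ip_ge0 (x : H) : 0 <= ip x x.
Proof.
have [->|x0] := eqVneq x 0; first by rewrite linear0l.
by rewrite ltW// neq0_dnorm_gt0.
Qed.

Hypothesis ipn : induces_norm ip.

Lemma le_normP (x : H) (c : R) : 0 <= c -> (`|x| <= c) = (ip x x <= c ^+ 2).
Proof. by move=> c0; rewrite -ipn ler_sqr ?nnegrE. Qed.

Lemma cauchy_schwarz (x y : H) : `|ip x y| <= `|x| * `|y|.
Proof.
have [->|y0] := eqVneq y 0; first by rewrite linear0r normr0 mulr_ge0.
have yy : 0 < ip y y by rewrite neq0_dnorm_gt0.
have := ip_ge0 (ip y y *: x - ip x y *: y).
rewrite !(ipBl, ipBr, ipZl, ipZr) (ipC y x) => h.
have {h} h : ip x y ^+ 2 <= ip x x * ip y y.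
  rewrite -subr_ge0 -(pmulr_rge0 _ yy); apply: le_trans h _.
  by rewrite le_eqVlt; apply/orP; left; apply/eqP; ring.
by rewrite -ler_sqr ?nnegrE ?mulr_ge0// exprMn !ipn real_normK ?num_real.
Qed.

Lemma cvg_ip T (F : set_system T) {FF : Filter F} (f g : T -> H) x y :
  f @ F --> x -> g @ F --> y -> (fun t => ip (f t) (g t)) @ F --> ip x y.
Proof.
move=> fx gy; apply/cvgrPdist_le => e e0.
pose M := `|x| + `|y| + 1.
have M1 : 0 < M by rewrite /M ltr_wpDl// addr_ge0.
have eM : 0 < e / (2 * M) by rewrite divr_gt0// mulr_gt0.
have g1 : \forall t \near F, `|g t| <= `|y| + 1.
  move/cvgrPdist_le : gy => /(_ 1 ltr01); apply: filterS => t.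
  rewrite distrC => h; rewrite -[g t](subrK y) (le_trans (ler_normD _ _))//.
  by rewrite addrC lerD2l.
move/cvgrPdist_le : fx => /(_ _ eM) fx.
move/cvgrPdist_le : gy => /(_ _ eM) gy.
near=> t.
have -> : ip x y - ip (f t) (g t) = ip (x - f t) (g t) + ip x (y - g t).
  by rewrite ipBl ipBr; ring.
rewrite (le_trans (ler_normD _ _))//.
have h1 : `|ip (x - f t) (g t)| <= e / (2 * M) * M.
  rewrite (le_trans (cauchy_schwarz _ _))// ler_pM//; first by near: t.
  apply: (@le_trans _ _ (`|y| + 1)); first by near: t.
  by rewrite /M -addrA lerDr.
have h2 : `|ip x (y - g t)| <= M * (e / (2 * M)).
  rewrite (le_trans (cauchy_schwarz _ _))// ler_pM//; last by near: t.
  by rewrite /M -addrA lerDl addr_ge0.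
rewrite (le_trans (lerD h1 h2))// le_eqVlt; apply/orP; left; apply/eqP.
by field; rewrite gt_eqF.
Unshelve. all: by end_near. Qed.

End InnerProduct.

(** * Orthonormal families and diagonal operators *)

Section Orthonormal.
Context {R : realType} {H : completeNormedModType R} (ip : {dot H for idfun}).
Context {I : choiceType} (D : set I) (e : I -> H).
Hypothesis e_ortho : forall i j, D i -> D j -> ip (e i) (e j) = (i == j)%:R.

Lemma ip_lincombl (s : seq I) (c : I -> R) j :
    uniq s -> (forall i, i \in s -> D i) -> D j ->
  ip (\sum_(i <- s) c i *: e i) (e j) = if j \in s then c j else 0.
Proof.
move=> us sD Dj; rewrite ip_suml.
rewrite (eq_big_seq (fun i => if i == j then c i else 0)); last first.
  move=> i /sD Di; rewrite ipZl e_ortho//.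
  by case: eqP => _; rewrite ?mulr1 ?mulr0.
rewrite -big_mkcond /=; case: ifPn => js.
  by rewrite (big_rem j)//= eqxx big_seq_cond big1 ?addr0// => i;
    rewrite mem_rem_uniq// !inE => /andP[/andP[/negbTE ->]].
by rewrite big_seq_cond big1// => i /andP[] /[swap] /eqP ->; rewrite (negbTE js).
Qed.

Lemma ip_lincomb (s : seq I) (c c' : I -> R) :
    uniq s -> (forall i, i \in s -> D i) ->
  ip (\sum_(i <- s) c i *: e i) (\sum_(i <- s) c' i *: e i)
  = \sum_(i <- s) c i * c' i.
Proof.
move=> us sD; rewrite ip_sumr; apply: eq_big_seq => i si.
by rewrite ipZr ip_lincombl ?si// 1?mulrC//; exact: sD.
Qed.

Lemma bessel (s : seq I) (x : H) :
    uniq s -> (forall i, i \in s -> D i) ->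
  \sum_(i <- s) ip (e i) x ^+ 2 <= ip x x.
Proof.
move=> us sD; set y := \sum_(i <- s) ip (e i) x *: e i.
have yy : ip y y = \sum_(i <- s) ip (e i) x ^+ 2.
  by rewrite ip_lincomb//; apply: eq_bigr => i _; rewrite expr2.
have yx : ip y x = \sum_(i <- s) ip (e i) x ^+ 2.
  by rewrite ip_suml; apply: eq_bigr => i _; rewrite ipZl expr2.
have := ip_ge0 ip (x - y).
rewrite !(ipBl, ipBr) (ipC ip x y) yx yy; lra.
Qed.

End Orthonormal.

Lemma totally_near (I : choiceType) (F0 : {fset I}) :
  \forall F \near @totally I, (F0 `<=` F)%fset.
Proof. by exists F0. Qed.

Section Basis.
Context {R : realType} {H : completeNormedModType R} (ip : {dot H for idfun}).
Hypothesis ipn : induces_norm ip.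
Context {I : choiceType} (D : set I) (e : I -> H).
Hypothesis e_basis : orthonormal_basis ip D e.

Let e_ortho i j : D i -> D j -> ip (e i) (e j) = (i == j)%:R.
Proof. exact: e_basis.1. Qed.

Let inD (P : set I) (F : {fset I}) := [seq i <- F | i \in P].

Let inD_uniq P F : uniq (inD P F).
Proof. by rewrite filter_uniq// fset_uniq. Qed.

Let inD_D P F i : P `<=` D -> i \in inD P F -> D i.
Proof. by move=> PD; rewrite mem_filter => /andP[/set_mem/PD]. Qed.

Let sum_inD P (F : {fset I}) (u : I -> H) :
  \sum_(i <- F | i \in P) u i = \sum_(i <- inD P F) u i.
Proof. by rewrite big_filter. Qed.

(** By orthogonality the increments of the weighted net are at most C times
    those of the expansion of x itself, which is Cauchy. *)
Lemma cvg_weighted_expansion (P : set I) (w : I -> R) (C : R) (x : H) :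
    P `<=` D -> (forall i, P i -> `|w i| <= C) ->
  cvg ((fun F : {fset I} => \sum_(i <- F | i \in P) w i *: tensor ip (e i) (e i) x)
        @ @totally I).
Proof.
move=> PD wC.
have {}wC i : P i -> w i ^+ 2 <= C ^+ 2.
  move=> /wC wiC; have C0 : 0 <= C by exact: le_trans wiC.
  by rewrite -[w i ^+ 2]real_normK ?num_real// ler_sqr ?nnegrE.
pose f := (fun F : {fset I} => \sum_(i <- F | i \in D) tensor ip (e i) (e i) x).
have fx : f @ totally --> x by exact: e_basis.2.
pose g := (fun F : {fset I} => \sum_(i <- F | i \in P) w i *: tensor ip (e i) (e i) x).
have gf (F0 F : {fset I}) : (F0 `<=` F)%fset ->
    ip (g F - g F0) (g F - g F0) <= C ^+ 2 * ip (f F - f F0) (f F - f F0).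
  move=> F0F.
  have split_sum (Q : set I) (u : I -> H) :
      \sum_(i <- F | i \in Q) u i - \sum_(i <- F0 | i \in Q) u i
      = \sum_(i <- inD Q (F `\` F0)%fset) u i.
    by rewrite (sum_fsetD _ _ F0F) addrAC subrr add0r sum_inD.
  rewrite /g /f !split_sum /tensor.
  under eq_bigr do rewrite scalerA.
  rewrite (ip_lincomb e_ortho)//; last by move=> i; exact: inD_D.
  rewrite (ip_lincomb e_ortho)//; last by move=> i; exact: inD_D.
  rewrite !big_filter big_distrr/= [leRHS]big_mkcond [leLHS]big_mkcond/=.
  apply: ler_sum => i _; case: ifPn => [/set_mem Pi|_].
    rewrite (mem_set (PD _ Pi)).
    rewrite -!expr2 exprMn; apply: ler_wpM2r; first exact: sqr_ge0.
    exact: wC.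
  by case: ifP => // _; rewrite mulr_ge0 ?sqr_ge0// -expr2 sqr_ge0.
apply: cauchy_cvg; apply: cauchy_exP => eps eps0.
pose d := eps / (2 * (`|C| + 1)).
have C1 : 0 < `|C| + 1 by rewrite ltr_wpDl.
have d0 : 0 < d by rewrite divr_gt0// mulr_gt0.
move/cvgrPdist_lt : fx => /(_ _ d0)[F0 _ F0f].
exists (g F0), F0 => // F /= F0F.
rewrite -ball_normE /ball_/= distrC.
have fF : `|f F - f F0| <= 2 * d.
  rewrite -[f F](subrK x) -addrA (le_trans (ler_normD _ _))// mulrDl mul1r.
  rewrite lerD//; last exact/ltW/F0f/fsubset_refl.
  by rewrite distrC; exact/ltW/F0f.
have : `|g F - g F0| <= `|C| * (2 * d).
  have d2 : 0 <= 2 * d by rewrite mulr_ge0// ltW.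
  rewrite (le_normP ipn); last exact: mulr_ge0.
  apply: le_trans (gf _ _ F0F) _.
  rewrite exprMn real_normK ?num_real// -ipn ler_wpM2l ?sqr_ge0//.
  by rewrite ler_sqr ?nnegrE.
move=> /le_lt_trans; apply.
have -> : `|C| * (2 * d) = `|C| / (`|C| + 1) * eps.
  by rewrite /d; field; rewrite gt_eqF.
by rewrite gtr_pMl// ltr_pdivrMr// mul1r ltrDl.
Qed.

Section WeightedSum.
Variables (P : set I) (w : I -> R) (C : R).
Hypotheses (PD : P `<=` D) (wC : forall i, P i -> `|w i| <= C) (C0 : 0 <= C).

Let T x := hsum P (fun i => w i *: tensor ip (e i) (e i) x).

Let psum x (F : {fset I}) := \sum_(i <- F | i \in P) w i *: tensor ip (e i) (e i) x.

Lemma cvg_hsum x : psum x @ @totally I --> T x.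
Proof. by apply: cvg_weighted_expansion => //; exact: wC. Qed.
Arguments cvg_hsum x : clear implicits.

Lemma ip_hsum x j : D j ->
  ip (e j) (T x) = if j \in P then w j * ip (e j) x else 0.
Proof.
move=> Dj; have h : (fun F => ip (e j) (psum x F)) @ @totally I --> ip (e j) (T x).
  by apply: (cvg_ip ipn); [exact: cvg_cst | exact: cvg_hsum].
apply: (cvg_unique (@norm_hausdorff _ R^o) h).
apply: cvg_near_cst; near=> F.
have jF : j \in F.
  by rewrite -fsub1set; near: F; exact: totally_near.
apply/eqP; rewrite ipC /psum /tensor sum_inD.
under eq_bigr do rewrite scalerA.
rewrite (ip_lincombl e_ortho)//; last by move=> i; exact: inD_D.
by rewrite mem_filter jF andbT.
Unshelve. all: by end_near. Qed.

Lemma hsum_le x : `|T x| <= C * `|x|.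
Proof.
rewrite (le_normP ipn); last exact: mulr_ge0.
have h : (fun F => ip (psum x F) (psum x F)) @ @totally I --> ip (T x) (T x).
  by apply: (cvg_ip ipn); exact: cvg_hsum.
apply: (@le_cvg _ _ _ _ _ (fun=> (C * `|x|) ^+ 2) _ _ h).
  exact: cvg_cst.
apply: nearW => F; rewrite /psum /tensor sum_inD.
under eq_bigr do rewrite scalerA.
rewrite (ip_lincomb e_ortho)//; last by move=> i; exact: inD_D.
rewrite exprMn ipn (le_trans _ (ler_wpM2l (sqr_ge0 _) (bessel e_ortho x (inD_uniq P F) _)))//.
  rewrite big_distrr/= !big_filter; apply: ler_sum => i /set_mem Pi.
  rewrite -expr2 exprMn ler_wpM2r ?sqr_ge0// -[w i ^+ 2]real_normK ?num_real//.
  by rewrite ler_sqr ?nnegrE// wC.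
by move=> i; exact: inD_D.
Qed.

Lemma hsumD x y : T (x + y) = T x + T y.
Proof.
have h : (fun F => psum x F + psum y F) @ @totally I --> T x + T y.
  by apply: cvgD; exact: cvg_hsum.
have hE : (fun F => psum x F + psum y F) = psum (x + y).
  apply/funext => F; rewrite /psum -big_split/=; apply: eq_bigr => i _.
  by rewrite /tensor ipDr scalerDl scalerDr.
rewrite hE in h; apply: (cvg_unique (@norm_hausdorff _ H) _ h).
exact: cvg_hsum.
Qed.

Lemma hsumZ a x : T (a *: x) = a *: T x.
Proof.
have h : (fun F => a *: psum x F) @ @totally I --> a *: T x.
  by apply: cvgZl_tmp; exact: cvg_hsum.
have hE : (fun F => a *: psum x F) = psum (a *: x).
  apply/funext => F; rewrite /psum scaler_sumr; apply: eq_bigr => i _.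
  by rewrite /tensor ipZr !scalerA mulrCA mulrA.
rewrite hE in h; apply: (cvg_unique (@norm_hausdorff _ H) _ h).
exact: cvg_hsum.
Qed.

End WeightedSum.

Lemma eq_from_coords x y : (forall j, D j -> ip (e j) x = ip (e j) y) -> x = y.
Proof.
move=> xy; apply/eqP; rewrite -subr_eq0; apply/eqP.
have h := e_basis.2 (x - y); apply: (cvg_unique (@norm_hausdorff _ H) h).
apply: cvg_near_cst; apply: nearW => F; apply/eqP; rewrite big1// => j /set_mem Dj.
by rewrite /tensor ipBr xy// subrr scale0r.
Qed.

(** Here p is the part of x outside P, given by its coordinates. *)
Lemma cvg_expansionB (P : set I) (x p : H) :
    P `<=` D -> (forall j, D j -> ip (e j) p = if j \in P then 0 else ip (e j) x) ->
  (fun F : {fset I} => \sum_(i <- F | i \in P) ip (e i) x *: e i) @ @totally I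
    --> x - p.
Proof.
move=> PD pE.
have n1 i : P i -> `|(fun=> 1 : R) i| <= 1 by rewrite normr1.
have -> : x - p = hsum P (fun i => 1 *: tensor ip (e i) (e i) x).
  apply: eq_from_coords => j Dj.
  rewrite (ip_hsum PD n1)// ipBr pE// mul1r.
  by case: ifP => _; rewrite ?subr0 ?subrr.
have -> : (fun F : {fset I} => \sum_(i <- F | i \in P) ip (e i) x *: e i)
        = (fun F : {fset I} => \sum_(i <- F | i \in P) 1 *: tensor ip (e i) (e i) x).
  by apply/funext => F; apply: eq_bigr => i _; rewrite scale1r.
exact: (@cvg_hsum P (fun=> 1) 1 PD n1 x).
Qed.

End Basis.

(** * Diagonalization of real symmetric matrices *)

Lemma linear_lincomb (R : nzRingType) (V W : lmodType R) (f : V -> W) (I : Type)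
    (r : seq I) (P : pred I) (c : I -> R) (a : I -> V) :
    (forall b x y, f (b *: x + y) = b *: f x + f y) ->
  f (\sum_(i <- r | P i) c i *: a i) = \sum_(i <- r | P i) c i *: f (a i).
Proof.
move=> fL; have f0 : f 0 = 0.
  have /eqP := fL 1 0 0; rewrite !scale1r addr0.
  by rewrite -subr_eq0 opprD addrA subrr add0r oppr_eq0 => /eqP.
by elim/big_rec2: _ => // i y x _ <-; rewrite fL.
Qed.

(** A linear system with more unknowns than equations has a nonzero solution;
    this is the dimension count behind every min-max argument below. *)
Lemma exists_combination_killed (R : fieldType) (V : lmodType R) n
    (a : 'I_n.+1 -> V) (phi : 'I_n -> V -> R) :
    (forall j b x y, phi j (b *: x + y) = b * phi j x + phi j y) ->
  exists2 c : 'I_n.+1 -> R, (exists i, c i != 0) &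
    forall j, phi j (\sum_i c i *: a i) = 0.
Proof.
move=> phiL; pose M := \matrix_(i < n.+1, j < n) phi j (a i).
have /rowV0Pn[v /sub_kermxP vM v0] : kermx M != 0.
  by rewrite kermx_eq0 /row_free neq_ltn ltnS rank_leq_col.
exists (fun i => v 0 i); first exact/rV0Pn.
move=> j; rewrite (@linear_lincomb R V R^o (phi j)); last exact: phiL.
have := congr1 (fun A : 'rV_n => A 0 j) vM; rewrite !mxE => vM0.
rewrite -[RHS]vM0; apply: eq_bigr => i _.
by rewrite mxE.
Qed.

Lemma continuous_bigsum (R : numFieldType) (T : topologicalType) (I : Type)
    (r : seq I) (f : I -> T -> R) :
  (forall i, continuous (f i)) -> continuous (fun x => \sum_(i <- r) f i x).
Proof.
move=> fc; elim: r => [|i r IH] x.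
  by under eq_fun do rewrite big_nil; exact: cvg_cst.
under eq_fun do rewrite big_cons.
by apply: cvgD; [exact: fc|exact: IH].
Qed.

Section SymmetricMatrix.
Context {R : realType} {n : nat}.

Definition dotv (u v : 'rV[R]_n) : R := (u *m v^T) 0 0.

Lemma dotvE u v : dotv u v = \sum_i u 0 i * v 0 i.
Proof. by rewrite /dotv mxE; apply: eq_bigr => i _; rewrite mxE. Qed.

Lemma dotvC u v : dotv u v = dotv v u.
Proof. by rewrite !dotvE; apply: eq_bigr => i _; rewrite mulrC. Qed.

Lemma dotvDl u v w : dotv (u + v) w = dotv u w + dotv v w.
Proof. by rewrite /dotv mulmxDl mxE. Qed.

Lemma dotvDr u v w : dotv u (v + w) = dotv u v + dotv u w.
Proof. by rewrite dotvC dotvDl !(dotvC u). Qed.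

Lemma dotvZl a u v : dotv (a *: u) v = a * dotv u v.
Proof. by rewrite /dotv -scalemxAl mxE. Qed.

Lemma dotvZr a u v : dotv u (a *: v) = a * dotv u v.
Proof. by rewrite dotvC dotvZl (dotvC u). Qed.

Lemma dotv_suml (I : Type) (r : seq I) (P : pred I) (F : I -> 'rV[R]_n) v :
  dotv (\sum_(i <- r | P i) F i) v = \sum_(i <- r | P i) dotv (F i) v.
Proof. by rewrite /dotv mulmx_suml summxE. Qed.

Lemma dotv_ge0 u : 0 <= dotv u u.
Proof. by rewrite dotvE sumr_ge0// => i _; rewrite -expr2 sqr_ge0. Qed.

Lemma dotv_eq0 u : (dotv u u == 0) = (u == 0).
Proof.
apply/eqP/eqP => [|->]; last by rewrite /dotv mul0mx mxE.
rewrite dotvE => /eqP; rewrite psumr_eq0; last first.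
  by move=> i _; rewrite -expr2 sqr_ge0.
move=> /allP u0; apply/rowP => i; rewrite mxE; apply/eqP.
by have := u0 i (mem_index_enum _); rewrite -expr2 sqrf_eq0.
Qed.

Variables (N : 'M[R]_n).
Hypothesis N_sym : N^T = N.

Let q u := dotv (u *m N) u.

Lemma dotvMC u v : dotv (u *m N) v = dotv u (v *m N).
Proof. by rewrite /dotv trmx_mul N_sym mulmxA. Qed.

Lemma continuous_quadratic (M : 'M[R]_n) : continuous (fun x : 'rV[R]_n => dotv (x *m M) x).
Proof.
have -> : (fun x : 'rV[R]_n => dotv (x *m M) x)
    = (fun x : 'rV_n => \sum_(i < n) \sum_(j < n) x 0 j * M j i * x 0 i).
  by apply/funext => x; rewrite dotvE; apply: eq_bigr => i _; rewrite mxE mulr_suml.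
apply: (@continuous_bigsum _ _ _ _ (fun i (x : 'rV[R]_n) =>
  \sum_(j < n) x 0 j * M j i * x 0 i)) => i.
apply: (@continuous_bigsum _ _ _ _ (fun j (x : 'rV[R]_n) => x 0 j * M j i * x 0 i)) => j x.
apply: (@continuousM _ _ (fun x : 'rV[R]_n => x 0 j * M j i)).
  apply: (@continuousM _ _ (fun x : 'rV[R]_n => x 0 j) (fun=> M j i)).
    exact: (@coord_continuous R 1 n 0 j x).
  exact: cst_continuous.
exact: (@coord_continuous R 1 n 0 i x).
Qed.

Lemma continuous_dotvr u : continuous (dotv u).
Proof.
have -> : dotv u = (fun x : 'rV_n => \sum_(i < n) u 0 i * x 0 i).
  by apply/funext => x; rewrite dotvE.
apply: (@continuous_bigsum _ _ _ _ (fun i (x : 'rV[R]_n) => u 0 i * x 0 i)) => i x.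
apply: (@continuousM _ _ (fun=> u 0 i)); first exact: cst_continuous.
exact: (@coord_continuous R 1 n 0 i x).
Qed.

Lemma compact_unit_sphere (u : nat -> 'rV[R]_n) k :
  compact [set x | dotv x x = 1 /\ forall j, (j < k)%N -> dotv (u j) x = 0].
Proof.
apply: bounded_closed_compact.
  exists 1; split=> // M M1 x [xx _].
  apply: le_trans (ltW M1); rewrite -[leLHS]/(mx_norm x) mx_normE.
  have -> : 1 = (1%:nng : {nonneg R})%:num by [].
  rewrite num_le; apply: bigmax_le => // -[i j] _; rewrite -num_le/= (ord1 i).
  rewrite -ler_sqr ?nnegrE// real_normK ?num_real// expr1n -xx.
  rewrite dotvE (bigD1 j)//= -expr2 lerDl sumr_ge0// => l _.
  by rewrite -expr2 sqr_ge0.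
have -> : [set x | dotv x x = 1 /\ forall j, (j < k)%N -> dotv (u j) x = 0] =
    (fun x : 'rV[R]_n => dotv (x *m 1%:M) x) @^-1` [set y | y = 1] `&`
    \bigcap_(j in [set j | (j < k)%N]) (dotv (u j) @^-1` [set y | y = 0]).
  by apply/seteqP; split => x /=; rewrite mulmx1.
apply: closedI.
  by apply: (continuous_closedP _).1; [exact: continuous_quadratic|exact: closed_eq].
apply: closed_bigI => j _.
by apply: (continuous_closedP _).1; [exact: continuous_dotvr|exact: closed_eq].
Qed.

(** A maximizer v of the Rayleigh quotient among the vectors orthogonal to the
    eigenvectors already found: its residual w = v N - m v is still orthogonal to
    them, and the first order condition at v in the direction w gives w = 0. *)
Lemma next_eigenvector k (u : nat -> 'rV[R]_n) (mu : nat -> R) :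
    (k < n)%N ->
    (forall i j, (i < k)%N -> (j < k)%N -> dotv (u i) (u j) = (i == j)%:R) ->
    (forall i, (i < k)%N -> u i *m N = mu i *: u i) ->
  exists v m, [/\ dotv v v = 1, forall i, (i < k)%N -> dotv (u i) v = 0,
    v *m N = m *: v &
    forall x, (forall i, (i < k)%N -> dotv (u i) x = 0) -> q x <= m * dotv x x].
Proof.
move=> kn uu uN.
pose V := [set x | forall j, (j < k)%N -> dotv (u j) x = 0].
have VD x y : V x -> V y -> V (x + y).
  by move=> Vx Vy j jk; rewrite dotvDr Vx// Vy// addr0.
have VZ a x : V x -> V (a *: x) by move=> Vx j jk; rewrite dotvZr Vx// mulr0.
have normalize x : x != 0 -> V x ->
    let y := (Num.sqrt (dotv x x))^-1 *: x in dotv y y = 1 /\ V y.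
  move=> x0 Vx /=; split; last exact: VZ.
  rewrite dotvZl dotvZr mulrA -expr2 exprVn sqr_sqrtr ?dotv_ge0// mulVf//.
  by rewrite dotv_eq0.
have [x x0 Vx] : exists2 x, x != 0 & V x.
  pose M := \matrix_(i < n, j < k) u j 0 i.
  have /rowV0Pn[x /sub_kermxP xM x0] : kermx M != 0.
    by rewrite kermx_eq0 /row_free neq_ltn (leq_ltn_trans (rank_leq_col _) kn).
  exists x => // j jk; have := congr1 (fun A : 'rV_k => A 0 (Ordinal jk)) xM.
  rewrite !mxE => xM0; rewrite -[RHS]xM0 dotvE; apply: eq_bigr => i _.
  by rewrite mxE mulrC.
have [v /set_mem[vv Vv] vmax] : exists2 v, v \in [set x | dotv x x = 1 /\ V x] &
    forall t, t \in [set x | dotv x x = 1 /\ V x] -> q t <= q v.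
  apply: EVT_max_rV.
  - by exists ((Num.sqrt (dotv x x))^-1 *: x); exact: normalize.
  - exact: compact_unit_sphere.
  - by apply: continuous_subspaceT; exact: continuous_quadratic.
pose m := q v; exists v, m.
have le_m y : V y -> q y <= m * dotv y y.
  move=> Vy; have [->|y0] := eqVneq y 0.
    by rewrite /q /dotv !mul0mx mxE mulr0.
  have /mem_set/vmax := normalize _ y0 Vy.
  rewrite /q -scalemxAl dotvZl dotvZr mulrA -expr2 exprVn sqr_sqrtr ?dotv_ge0//.
  rewrite mulrC ler_pdivrMr// lt_neqAle eq_sym dotv_eq0 y0 dotv_ge0//.
split=> //.
have [w wE] : {w | w = v *m N - m *: v} by exists (v *m N - m *: v).
have Vw : V w.
  rewrite wE; apply: VD; last by rewrite -scaleNr; apply: VZ.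
  by move=> j jk; rewrite -dotvMC uN// dotvZl Vv// mulr0.
apply/eqP; rewrite -subr_eq0 -wE -dotv_eq0; apply/eqP.
have qC y z : dotv (y *m N) z = dotv (z *m N) y by rewrite dotvMC dotvC.
have ww : dotv (v *m N) w = m * dotv v w + dotv w w.
  by rewrite -dotvZl -dotvDl wE [m *: v + _]addrC subrK.
have [a aE] : {a | a = dotv w w} by exists (dotv w w).
have a0 : 0 <= a by rewrite aE dotv_ge0.
have [C CE] : {C | C = m * a - q w} by exists (m * a - q w).
have C0 : 0 <= C by rewrite CE aE subr_ge0 le_m.
rewrite -aE in ww *; pose t := a / (C + 1).
(* moving from v by t w changes m |x|^2 - q x by t (t C - 2 a), which is
   negative for this t unless a = 0 *)
have /le_m : V (v + t *: w) by apply: VD => //; exact: VZ.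
rewrite /q mulmxDl -scalemxAl !(dotvDl, dotvDr, dotvZl, dotvZr).
rewrite (qC w v) ww (dotvC w v) vv -aE -/(q w) -/(q v) -/m => h.
have {h} h : 0 <= t * (t * C - 2 * a) by rewrite CE; lra.
have C1 : 0 < C + 1 by rewrite ltr_wpDl.
have tC : t * C - 2 * a <= - a.
  have : t * C <= a; last lra.
  by rewrite /t mulrAC ler_pdivrMr// ler_wpM2l// lerDl.
have t0 : 0 <= t by rewrite divr_ge0// ltW.
have /eqP : t * a = 0.
  apply/eqP; rewrite eq_le mulr_ge0// andbT -oppr_ge0 -mulrN.
  exact: le_trans h (ler_wpM2l t0 tC).
by rewrite /t mulf_eq0 mulf_eq0 invr_eq0 (gt_eqF C1) orbF orbb => /eqP.
Qed.

(** The third clause is the max part of the Courant-Fischer principle; taken at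
    x = u k with k > i, it says that mu is nonincreasing. *)
Definition diagonalization (u : nat -> 'rV[R]_n) (mu : nat -> R) : Prop :=
  [/\ forall i j, (i < n)%N -> (j < n)%N -> dotv (u i) (u j) = (i == j)%:R,
      forall i, (i < n)%N -> u i *m N = mu i *: u i,
      forall i, (i < n)%N -> forall x, (forall j, (j < i)%N -> dotv (u j) x = 0) ->
        dotv (x *m N) x <= mu i * dotv x x &
      \sum_(i < n) mu i = \tr N].

Lemma symmetric_diagonalization : exists u mu, diagonalization u mu.
Proof.
pose good k (u : nat -> 'rV[R]_n) (mu : nat -> R) := [/\
  forall i j, (i < k)%N -> (j < k)%N -> dotv (u i) (u j) = (i == j)%:R,
  forall i, (i < k)%N -> u i *m N = mu i *: u i &
  forall i, (i < k)%N -> forall x, (forall j, (j < i)%N -> dotv (u j) x = 0) ->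
    dotv (x *m N) x <= mu i * dotv x x].
have [u [mu [uu uN umax]]] : exists u mu, good n u mu.
  suff h k : (k <= n)%N -> exists u mu, good k u mu by exact: h.
  elim: k => [_|k IH kn].
    by exists (fun=> 0), (fun=> 0); split.
  have [u [mu [uu uN umax]]] := IH (ltnW kn).
  have [v [m [vv uv vN vmax]]] := next_eigenvector kn uu uN.
  exists (fun i => if i == k then v else u i), (fun i => if i == k then m else mu i).
  split.
  - move=> i j; rewrite !ltnS.
    have [->|ik] := eqVneq i k; have [->|jk] := eqVneq j k.
    + by rewrite vv.
    + move=> _ jk'; have jk1 : (j < k)%N by rewrite ltn_neqAle jk.
      by rewrite mulrb dotvC uv.
    + move=> ik' _; have ik1 : (i < k)%N by rewrite ltn_neqAle ik.
      by rewrite mulrb (negbTE ik) uv.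
    + by move=> ik' jk'; rewrite uu// ltn_neqAle ?ik// jk.
  - move=> i; rewrite ltnS; have [//|ik ik'] := eqVneq i k.
    by rewrite uN// ltn_neqAle ik.
  - move=> i; rewrite ltnS => ik' x; have [->|ik] := eqVneq i k.
    + by move=> ux; apply: vmax => j jk; have := ux j jk; rewrite ltn_eqF.
    + move=> ux; apply: umax; first by rewrite ltn_neqAle ik.
      move=> j ji; have := ux j ji; rewrite ltn_eqF//.
      exact: leq_trans ji ik'.
exists u, mu; split=> //.
pose U := \matrix_(i < n) u i.
have UU : U *m U^T = 1%:M.
  apply/matrixP => i j; rewrite !mxE -[RHS]uu ?ltn_ord// dotvE.
  by apply: eq_bigr => l _; rewrite !mxE.
have -> : \tr N = \tr (U *m N *m U^T).
  by rewrite mxtrace_mulC mulmxA (mulmx1C UU) mul1mx.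
apply: eq_bigr => i _; rewrite !mxE.
rewrite (_ : \sum_j _ = dotv (u i *m N) (u i)); last first.
  rewrite dotvE; apply: eq_bigr => l _; rewrite !mxE; congr (_ * _).
  by apply: eq_bigr => r _; rewrite !mxE.
by rewrite uN// dotvZl uu// eqxx mulr1.
Qed.

(** The min part of the Courant-Fischer principle. *)
Lemma diagonalization_span u mu i (r : seq nat) (c : nat -> R) :
    diagonalization u mu -> (i < n)%N -> uniq r -> (forall j, j \in r -> (j <= i)%N) ->
  let x := \sum_(j <- r) c j *: u j in
  dotv x x = \sum_(j <- r) c j ^+ 2 /\ mu i * dotv x x <= dotv (x *m N) x.
Proof.
move=> [uu uN umax _] ni ur ri x.
have rn j : j \in r -> (j < n)%N by move=> /ri ji; exact: leq_ltn_trans ji ni.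
have ux j : j \in r -> dotv (u j) x = c j.
  move=> jr; rewrite dotvC dotv_suml (bigD1_seq j)//= dotvZl uu ?rn// eqxx mulr1.
  rewrite big_seq_cond big1 ?addr0// => l /andP[lr lj].
  by rewrite dotvZl uu ?rn// (negbTE lj) mulr0.
have xx : dotv x x = \sum_(j <- r) c j ^+ 2.
  rewrite {1}/x dotv_suml; apply: eq_big_seq => j jr.
  by rewrite dotvZl ux// expr2.
split=> //; rewrite xx mulr_sumr {1}/x mulmx_suml dotv_suml.
rewrite big_seq [leRHS]big_seq; apply: ler_sum => j jr.
rewrite -scalemxAl uN ?rn// !dotvZl ux// [leRHS]mulrCA -expr2 ler_wpM2r ?sqr_ge0//.
have := umax j (rn j jr) (u i); rewrite uN// dotvZl uu// eqxx !mulr1; apply.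
move=> l lj; have ln := ltn_trans lj (rn _ jr).
by rewrite uu// ltn_eqF// (leq_trans lj)// ri.
Qed.

End SymmetricMatrix.

(** * The gap, the weights and the block form of the perturbation *)

Section BoundedOperators.
Context {R : realType} {H : completeNormedModType R}.

Lemma compact_operator_bounded (A : {linear H -> H}) : compact_operator A ->
  exists2 C, 0 <= C & forall x, `|A x| <= C * `|x|.
Proof.
move=> /compact_bounded[M [_ MA]]; exists (`|M| + 1); first by rewrite addr_ge0.
move=> x; have [->|x0] := eqVneq x 0; first by rewrite linear0 !normr0 mulr0.
have nx : 0 < `|x| by rewrite normr_gt0.
have MM : M < `|M| + 1 by rewrite (le_lt_trans (ler_norm _))// ltrDl.
have xA : (A @` [set y | `|y| <= 1]) (A (`|x|^-1 *: x)).
  exists (`|x|^-1 *: x) => //=.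
  by rewrite normrZ normfV normr_id mulVf// gt_eqF.
have := MA _ MM _ (subset_closure xA).
by rewrite /= linearZ/= normrZ normfV normr_id mulrC ler_pdivrMr.
Qed.

(** The bound C makes the supremum defining the operator norm a genuine one. *)
Lemma op_norm_ge (T : H -> H) (C : R) :
    0 <= C -> (forall x, `|T x| <= C * `|x|) -> (forall a x, T (a *: x) = a *: T x) ->
  forall x, `|T x| <= op_norm T * `|x|.
Proof.
move=> C0 TC TZ x.
have ub y : `|y| <= 1 -> `|T y| <= op_norm T.
  move=> y1; apply: ub_le_sup; last by exists y.
  exists C => _ [z z1 <-]; rewrite (le_trans (TC z))// -[leRHS]mulr1.
  exact: ler_wpM2l.
have [->|x0] := eqVneq x 0.
  by have := TZ 0 0; rewrite !scale0r => ->; rewrite !normr0 mulr0.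
have nx : 0 < `|x| by rewrite normr_gt0.
rewrite -ler_pdivrMr//; have := ub (`|x|^-1 *: x).
rewrite TZ !normrZ normfV normr_id mulVf ?gt_eqF// [_ * `|T x|]mulrC.
exact.
Qed.

End BoundedOperators.

Section SpectralGap.
Context {R : realType} {H : completeNormedModType R} {ip : {dot H for idfun}}.
Hypothesis ipn : induces_norm ip.
Context {A : {linear H -> H}} (S : eigensystem ip A) (J : {fset nat}).
Hypothesis J_neq0 : J != fset0.
Hypothesis J_S : forall k, k \in J -> eidx S (inl k).
Hypothesis gap_gt0 : 0 < gap S J.

Local Notation e := (evec S).
Local Notation out := (outside S J).
Local Notation comb s c := (\sum_(i <- s) c i *: e i).
Let e_basis : orthonormal_basis ip (eidx S) e := evec_basis S.
Let e_ortho i j : eidx S i -> eidx S j -> ip (e i) (e j) = (i == j)%:R.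
Proof. exact: e_basis.1. Qed.

Definition gdist (i : nat + nat) : R := dist_block S J (eigval S i).

Lemma outside_sub : out `<=` eidx S. Proof. by move=> i []. Qed.

Lemma outside_inl k : eidx S (inl k) -> (inl k \in out) = (k \notin J).
Proof.
move=> Sk; apply/idP/idP => [/set_mem[_ h]|kJ].
  by apply/negP => kJ; apply: h; exists k.
by apply/mem_set; split=> // -[l lJ [lk]]; move: kJ; rewrite -lk => /negP; apply.
Qed.

Lemma gap_le k i : k \in J -> out i -> gap S J <= `|lam S k - eigval S i|.
Proof.
move=> kJ oi; apply: ge_inf; last by exists k => //; exists i.
by exists 0 => _ [l _ [j _ <-]].
Qed.

Lemma dist_block_le t m : m \in J -> dist_block S J t <= `|t - lam S m|.
Proof.
move=> mJ; apply: ge_inf; last by exists m.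
by exists 0 => _ [l _ <-].
Qed.

Lemma gap_le_gdist i : out i -> gap S J <= gdist i.
Proof.
move=> oi; apply: lb_le_inf.
  by have [k kJ] := fset0Pn _ J_neq0; exists `|eigval S i - lam S k|, k.
by move=> _ [k kJ <-]; rewrite distrC; exact: gap_le.
Qed.

Lemma gdist_gt0 i : out i -> 0 < gdist i.
Proof. by move=> /gap_le_gdist; exact: lt_le_trans. Qed.

Lemma theta_min_le_max : theta_min S J <= theta_max S J.
Proof.
have [k kJ] := fset0Pn _ J_neq0.
have fin : finite_set [set lam S k | k in [set` J]].
  by apply: finite_image; exact: finite_fset.
apply: (@le_trans _ _ (lam S k)).
  apply: ge_inf; last by exists k.
  exists 0 => _ [l lJ <-]; exact/eigval_ge0/J_S.
apply: ub_le_sup; last by exists k.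
exists (lam S 0) => _ [l lJ <-].
by apply: eigval_noninc => //; exact: J_S.
Qed.

Local Notation w i := ((Num.sqrt (gdist i))^-1).
Local Notation C := ((Num.sqrt (gap S J))^-1).

Let C0 : 0 <= C. Proof. by rewrite invr_ge0 sqrtr_ge0. Qed.

Let wC i : out i -> `|w i| <= C.
Proof.
move=> oi; rewrite ger0_norm ?invr_ge0 ?sqrtr_ge0//.
rewrite lef_pV2 ?posrE ?sqrtr_gt0 ?gdist_gt0// ler_wsqrtr//.
exact: gap_le_gdist.
Qed.

Local Notation Rs := (abs_resolvent_sqrt S J).

Lemma ip_resolvent x j : eidx S j ->
  ip (e j) (Rs x) = if j \in out then w j * ip (e j) x else 0.
Proof. exact: (ip_hsum ipn e_basis outside_sub wC). Qed.

Lemma resolvent_le x : `|Rs x| <= C * `|x|.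
Proof. exact: (hsum_le ipn e_basis outside_sub wC C0). Qed.

Lemma resolventD x y : Rs (x + y) = Rs x + Rs y.
Proof. exact: (hsumD ipn e_basis outside_sub wC). Qed.

Lemma resolventZ a x : Rs (a *: x) = a *: Rs x.
Proof. exact: (hsumZ ipn e_basis outside_sub wC). Qed.

Lemma resolvent_diff_linear (Ah : {linear H -> H}) a x y :
  Rs ((Ah \- A) (a *: x + y)) = a *: Rs ((Ah \- A) x) + Rs ((Ah \- A) y).
Proof.
rewrite /= (linearP Ah) (linearP A) opprD addrACA -scalerBr.
by rewrite resolventD resolventZ.
Qed.

Local Notation sJ := ([seq inl k | k <- J] : seq (nat + nat)).

Let sJ_uniq : uniq sJ.
Proof. by rewrite map_inj_uniq ?fset_uniq// => i j []. Qed.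

Let sJ_sub i : i \in sJ -> eidx S i.
Proof. by move=> /mapP[k kJ ->]; exact: J_S. Qed.

Let sJ_out j : eidx S j -> (j \in sJ) = (j \notin out).
Proof.
move=> Sj; apply/idP/idP => [/mapP[k kJ ->]|/negP jo].
  by rewrite outside_inl ?negbK//; exact: J_S.
rewrite -[_ \in _]negbK; apply/negP => /negP js; apply: jo; apply/mem_set.
by split=> // -[k kJ kj]; apply: js; apply/mapP; exists k.
Qed.

Lemma block_projE x : block_proj S J x = \sum_(i <- sJ) ip (e i) x *: e i.
Proof. by rewrite big_map. Qed.

Lemma ip_block_proj x j : eidx S j ->
  ip (e j) (block_proj S J x) = if j \in out then 0 else ip (e j) x.
Proof.
move=> Sj; rewrite block_projE ipC (ip_lincombl e_ortho)// sJ_out//.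
exact: if_neg.
Qed.

Lemma block_projZ a x : block_proj S J (a *: x) = a *: block_proj S J x.
Proof.
by rewrite !block_projE scaler_sumr; apply: eq_bigr => i _; rewrite ipZr scalerA.
Qed.

Lemma block_proj_le x : `|block_proj S J x| <= `|x|.
Proof.
rewrite (le_normP ipn)// block_projE (ip_lincomb e_ortho)// ipn.
under eq_bigr do rewrite -expr2.
exact: (bessel e_ortho).
Qed.

(** The eigenvalues of the inverse of T_J, the square of [weight_sqrt]. *)
Definition blockweight i : R := if i \in out then gdist i else gap S J.

Lemma blockweight_gt0 i : 0 < blockweight i.
Proof. by rewrite /blockweight; case: ifP => // /set_mem; exact: gdist_gt0. Qed.

Local Notation W := (weight_sqrt S J).

Lemma ip_weight x j : eidx S j ->
  ip (e j) (W x) = (Num.sqrt (blockweight j))^-1 * ip (e j) x.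
Proof.
move=> Sj; rewrite ipDr ipZr ip_block_proj// ip_resolvent// /blockweight.
by case: ifP => _; rewrite ?mulr0 ?add0r ?addr0.
Qed.

Lemma weight_le x : `|W x| <= (C + C) * `|x|.
Proof.
rewrite (le_trans (ler_normD _ _))// mulrDl lerD ?resolvent_le//.
by rewrite normrZ ger0_norm// ler_wpM2l// block_proj_le.
Qed.

Lemma weightZ a x : W (a *: x) = a *: W x.
Proof.
by rewrite /weight_sqrt block_projZ resolventZ scalerDr !scalerA [a * _]mulrC.
Qed.

(** [weight_sqrt] is inverted explicitly on finite combinations of eigenvectors,
    where its inverse is defined without any convergence question. *)
Lemma weight_lincomb (s : seq (nat + nat)) c : uniq s -> (forall i, i \in s -> eidx S i) ->
  W (\sum_(i <- s) (Num.sqrt (blockweight i) * c i) *: e i) = \sum_(i <- s) c i *: e i.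
Proof.
move=> us sS; apply: (eq_from_coords e_basis) => j Sj.
rewrite ip_weight// ![ip (e j) _]ipC !(ip_lincombl e_ortho)//.
case: ifP; rewrite ?mulr0// mulKf// gt_eqF// sqrtr_gt0.
by rewrite blockweight_gt0.
Qed.

Lemma eigen_lincomb (s : seq (nat + nat)) c : (forall i, i \in s -> eidx S i) ->
  A (\sum_(i <- s) c i *: e i) = \sum_(i <- s) (eigval S i * c i) *: e i.
Proof.
move=> sS; rewrite linear_sum; apply: eq_big_seq => i /sS Si.
by rewrite linearZ/= evec_eigen// scalerA mulrC.
Qed.

Section Perturbation.
Context {Ah : {linear H -> H}}.
Hypotheses (A_compact : compact_operator A) (Ah_compact : compact_operator Ah).
Hypotheses (A_sa : self_adjoint ip A) (Ah_sa : self_adjoint ip Ah).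
Hypothesis alpha_le : alpha S J Ah <= 1 / 4.

Local Notation E := (Ah \- A).

(** If x = W z with W = [weight_sqrt], then <E x, x> = <W E W z, z>, at most
    alpha |z|^2, and |z|^2 is the right-hand sum. *)
Lemma perturbation_form_le (s : seq (nat + nat)) c :
    uniq s -> (forall i, i \in s -> eidx S i) ->
  `|ip (E (comb s c)) (comb s c)| <= 1 / 4 * \sum_(i <- s) blockweight i * c i ^+ 2.
Proof.
move=> us sS; set x := comb s c; pose z := \sum_(i <- s) (Num.sqrt (blockweight i) * c i) *: e i.
have Wz : W z = x by exact: weight_lincomb.
have zz : ip z z = \sum_(i <- s) blockweight i * c i ^+ 2.
  rewrite (ip_lincomb e_ortho)//; apply: eq_bigr => i _.
  by rewrite -expr2 exprMn sqr_sqrtr// ltW// blockweight_gt0.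
have WC v : ip v (W z) = ip (W v) z.
  rewrite Wz /x /z !ip_sumr; apply: eq_big_seq => i /sS Si.
  rewrite !ipZr [in RHS]ipC ip_weight// [ip v _]ipC; field.
  by rewrite gt_eqF// sqrtr_gt0 blockweight_gt0.
have [CA CA0 hA] := compact_operator_bounded A_compact.
have [Ch Ch0 hAh] := compact_operator_bounded Ah_compact.
have opn := @op_norm_ge _ _ (W \o E \o W) ((C + C) * ((Ch + CA) * (C + C))).
have CC : 0 <= C + C by rewrite addr_ge0.
have {}opn : forall x, `|(W \o E \o W) x| <= alpha S J Ah * `|x|.
  apply: opn.
  - by rewrite !mulr_ge0// addr_ge0.
  - move=> v; rewrite /= (le_trans (weight_le _))// -!mulrA ler_wpM2l//.
    rewrite (le_trans (ler_normB _ _))// mulrDl lerD//.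
      by rewrite (le_trans (hAh _))// ler_wpM2l// weight_le.
    by rewrite (le_trans (hA _))// ler_wpM2l// weight_le.
  - by move=> a v; rewrite /= weightZ (linearZZ Ah) (linearZZ A) -scalerBr weightZ.
rewrite -zz -{1 2}Wz WC (le_trans (cauchy_schwarz ipn _ _))//.
rewrite -ipn expr2 mulrA ler_wpM2r//.
by rewrite (le_trans (opn z))// ler_wpM2r.
Qed.

Lemma block_part_form_le p : (forall i, out i -> ip (e i) p = 0) ->
  `|ip (Ah p) p - \sum_(k <- J) lam S k * ip (psi S k) p ^+ 2|
  <= gap S J / 4 * ip p p.
Proof.
move=> p_out; have pE : p = comb sJ (fun i => ip (e i) p).
  rewrite -block_projE; apply: (eq_from_coords e_basis) => j Sj.
  by rewrite ip_block_proj//; case: ifPn => // /set_mem/p_out.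
have pp : ip p p = \sum_(i <- sJ) ip (e i) p ^+ 2.
  by rewrite {1 2}pE (ip_lincomb e_ortho)//; under eq_bigr do rewrite -expr2.
have App : ip (A p) p = \sum_(k <- J) lam S k * ip (psi S k) p ^+ 2.
  rewrite {1 2}pE eigen_lincomb// (ip_lincomb e_ortho)// big_map.
  by apply: eq_bigr => k _; rewrite expr2 mulrA.
have -> : ip (Ah p) p = ip (A p) p + ip (E p) p by rewrite -ipDl /= addrC subrK.
rewrite App addrAC subrr add0r.
have := perturbation_form_le (fun i => ip (e i) p) sJ_uniq sJ_sub.
rewrite -pE => /le_trans; apply; rewrite pp !mulr_sumr le_eqVlt.
apply/orP; left; apply/eqP; apply: eq_big_seq => i iJ.
rewrite /blockweight; move: (iJ); rewrite sJ_out; last exact: sJ_sub.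
by move=> /negbTE ->; ring.
Qed.

(** Since <E p, y> = <Rs E p, z> for the rescaled vector z with coordinates
    sqrt g_l y_l, this is 2 a b <= 2 a^2 + b^2 / 2.  The weight 1/2, added to the
    1/4 coming from <E y, y>, gives the 3/4 of [block_form]. *)
Lemma cross_term_le p (s : seq (nat + nat)) c :
    uniq s -> (forall i, i \in s -> out i) ->
  `|2 * ip (E p) (\sum_(i <- s) c i *: e i)| <=
  2 * ip (Rs (E p)) (Rs (E p)) + 1 / 2 * \sum_(i <- s) gdist i * c i ^+ 2.
Proof.
move=> us so; pose z := \sum_(i <- s) (Num.sqrt (gdist i) * c i) *: e i.
have sS i : i \in s -> eidx S i by move=> /so; exact: outside_sub.
have zz : ip z z = \sum_(i <- s) gdist i * c i ^+ 2.
  rewrite (ip_lincomb e_ortho)//; apply: eq_big_seq => i /so oi.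
  by rewrite -expr2 exprMn sqr_sqrtr// ltW// gdist_gt0.
have -> : ip (E p) (\sum_(i <- s) c i *: e i) = ip (Rs (E p)) z.
  rewrite /z !ip_sumr; apply: eq_big_seq => i si.
  have oi := mem_set (so _ si).
  rewrite !ipZr [in RHS]ipC (ip_resolvent _ (sS _ si)) oi ipC; field.
  by rewrite gt_eqF// sqrtr_gt0 gdist_gt0//; exact: so.
rewrite -zz; set v := Rs (E p).
have h1 := ip_ge0 ip (2 *: v + z); have h2 := ip_ge0 ip (2 *: v - z).
rewrite !(ipBl, ipBr, ipDl, ipDr, ipZl, ipZr) (ipC ip z v) in h1 h2.
rewrite ler_norml; apply/andP; split; lra.
Qed.

(** The cross terms of A vanish, those of E are split by [cross_term_le], and the
    form of E on y is controlled by [perturbation_form_le].  The block part of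
    either bound involves p only, the rest only the coordinates of y. *)
Lemma block_form p (s : seq (nat + nat)) c :
    (forall i, out i -> ip (e i) p = 0) ->
    uniq s -> (forall i, i \in s -> out i) ->
  let y := comb s c in
  (ip (Ah (p + y)) (p + y) <=
    ip (Ah p) p + 2 * ip (Rs (E p)) (Rs (E p))
    + \sum_(i <- s) (eigval S i + 3 / 4 * gdist i) * c i ^+ 2) /\
  (ip (Ah p) p - 2 * ip (Rs (E p)) (Rs (E p))
    + \sum_(i <- s) (eigval S i - 3 / 4 * gdist i) * c i ^+ 2 <=
  ip (Ah (p + y)) (p + y)).
Proof.
move=> p_out us so y.
have sS i : i \in s -> eidx S i by move=> /so; exact: outside_sub.
have Apy : ip (A p) y = 0.
  rewrite ip_sumr big_seq big1// => i si.
  rewrite ipZr A_sa (evec_eigen (sS _ si)) ipZr ipC p_out ?mulr0//.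
  exact: so.
have Ayy : ip (A y) y = \sum_(i <- s) eigval S i * c i ^+ 2.
  rewrite /y eigen_lincomb// (ip_lincomb e_ortho)//.
  by apply: eq_bigr => i _; rewrite expr2 mulrA.
have Eyy : `|ip (E y) y| <= 1 / 4 * \sum_(i <- s) gdist i * c i ^+ 2.
  have -> : \sum_(i <- s) gdist i * c i ^+ 2 = \sum_(i <- s) blockweight i * c i ^+ 2.
    by apply: eq_big_seq => i /so oi; rewrite /blockweight mem_set.
  exact: perturbation_form_le.
have Epy := cross_term_le p c us so.
rewrite -/y in Epy.
have AhE x z : ip (Ah x) z = ip (A x) z + ip (E x) z.
  by rewrite -ipDl /= addrC subrK.
have -> : ip (Ah (p + y)) (p + y) = ip (Ah p) p + 2 * ip (E p) y
    + (\sum_(i <- s) eigval S i * c i ^+ 2 + ip (E y) y).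
  have -> : ip (Ah (p + y)) (p + y) = ip (Ah p) p + 2 * ip (Ah p) y + ip (Ah y) y.
    by rewrite (linearD Ah) !(ipDl, ipDr) (Ah_sa y p) (ipC ip y (Ah p)); ring.
  by rewrite -Ayy -AhE (AhE p y) Apy add0r.
have sumE a : \sum_(i <- s) (eigval S i + a * gdist i) * c i ^+ 2
    = \sum_(i <- s) eigval S i * c i ^+ 2 + a * \sum_(i <- s) gdist i * c i ^+ 2.
  rewrite mulr_sumr -big_split; apply: eq_bigr => i _.
  by rewrite mulrDl mulrA.
have := sumE (- (3 / 4)); under eq_bigr do rewrite mulNr.
move=> ->; rewrite sumE.
by move: Eyy Epy; rewrite !ler_norml => /andP[? ?] /andP[? ?]; split; lra.
Qed.

End Perturbation.
End SpectralGap.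

(** * The Hilbert-Schmidt norm in an arbitrary basis *)

Lemma cvg_bigsum (R : realType) (T K : Type) (F : set_system T) {FF : Filter F}
    (s : seq K) (f : K -> T -> R) (a : K -> R) :
  (forall k, f k @ F --> a k) ->
  (fun t => \sum_(k <- s) f k t) @ F --> \sum_(k <- s) a k.
Proof.
move=> fa; elim: s => [|k s IH].
  rewrite big_nil (_ : (fun t => _) = cst 0); first exact: cvg_cst.
  by apply/funext => t; rewrite big_nil.
rewrite big_cons (_ : (fun t => _) = f k \+ (fun t => \sum_(k <- s) f k t)).
  by apply: cvgD; [exact: fa|exact: IH].
by apply/funext => t; rewrite big_cons.
Qed.

Section HilbertSchmidt.
Context {R : realType} {H : completeNormedModType R} (ip : {dot H for idfun}).
Hypothesis ipn : induces_norm ip.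
Context {I : choiceType} (D : set I) (e : I -> H).
Hypothesis e_basis : orthonormal_basis ip D e.

(** Expanding the norms, the partial sums over e of |L e_i|^2 increase to
    sum_(k, l) <f_k, f_l> <v_k, v_l> by Parseval; that is the left-hand side.  The
    same limit bounds them, so the extended sum in [hs_norm] is finite and [fine]
    does not truncate it. *)
Lemma hs_norm_ge (K : eqType) (s : seq K) (f v : K -> H) :
    uniq s -> {in s &, forall k l, ip (f k) (f l) = (k == l)%:R} ->
  \sum_(k <- s) ip (v k) (v k)
  <= hs_norm D e (fun x => \sum_(k <- s) ip (f k) x *: v k) ^+ 2.
Proof.
move=> us ff; pose L x := \sum_(k <- s) ip (f k) x *: v k.
pose V := \sum_(k <- s) ip (v k) (v k).
pose fF k (F : {fset I}) := \sum_(i <- F | i \in D) tensor ip (e i) (e i) (f k).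
pose T (F : {fset I}) := \sum_(i <- F | i \in D) `|L (e i)| ^+ 2.
have TE F : T F = \sum_(k <- s) \sum_(l <- s) ip (fF k F) (f l) * ip (v k) (v l).
  rewrite /T; under eq_bigr do rewrite ipn ip_suml.
  rewrite exchange_big/=; apply: eq_bigr => k _.
  under eq_bigr do rewrite ipZl ip_sumr mulr_sumr.
  rewrite exchange_big/=; apply: eq_bigr => l _.
  rewrite /fF ip_suml mulr_suml; apply: eq_bigr => i _.
  by rewrite /tensor ipZr ipZl (ipC ip (e i) (f k)) (ipC ip (e i) (f l)) mulrA.
have TV : T @ @totally I --> V.
  rewrite (_ : T = fun F =>
    \sum_(k <- s) \sum_(l <- s) ip (fF k F) (f l) * ip (v k) (v l)); last first.
    exact/funext.
  have -> : V = \sum_(k <- s) \sum_(l <- s) ip (f k) (f l) * ip (v k) (v l).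
    rewrite /V; apply: eq_big_seq => k ks; rewrite (bigD1_seq k)//= ff// eqxx mul1r.
    rewrite big_seq_cond big1 ?addr0// => l /andP[ls lk].
    by rewrite ff// eq_sym (negbTE lk) mul0r.
  apply: cvg_bigsum => k; apply: cvg_bigsum => l.
  apply: cvgMr_tmp; apply: (cvg_ip ipn); last exact: cvg_cst.
  exact: e_basis.2.
have T_mono (F F' : {fset I}) : (F `<=` F')%fset -> T F <= T F'.
  by move=> FF'; rewrite /T (sum_fsetD _ _ FF') lerDl sumr_ge0.
have T_le F : T F <= V.
  apply: (@le_cvg _ _ (@totally I) _ (fun=> T F) T) => //; first exact: cvg_cst.
  by exists F => // F' /T_mono.
have esumV : (\esum_(i in D) (`|L (e i)| ^+ 2)%:E <= V%:E)%E.
  apply: ge_ereal_sup => _ [X [finX XD] <-].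
  rewrite fsbig_finite//= sumEFin lee_fin; apply: le_trans (T_le (fset_set X)).
  rewrite le_eqVlt /T [X in _ == X]big_mkcond/=; apply/orP; left; apply/eqP.
  apply: eq_big_seq => i; rewrite in_fset_set// => /set_mem/XD Di.
  by rewrite mem_set.
have esumT F : ((T F)%:E <= \esum_(i in D) (`|L (e i)| ^+ 2)%:E)%E.
  apply: esum_ge; exists ([set` F] `&` D).
    by split; [exact: finite_setIl|exact: subIsetr].
  rewrite fsbig_finite//=; last exact: finite_setIl.
  rewrite sumEFin lee_fin /T -big_filter le_eqVlt; apply/orP; left; apply/eqP.
  apply: perm_big; apply: uniq_perm; rewrite ?filter_uniq ?fset_uniq// => i.
  rewrite in_fset_set; last exact: finite_setIl.
  by rewrite mem_filter in_setI andbC; congr andb; apply/idP/idP => [/mem_set|/set_mem].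
have esum_fin : (\esum_(i in D) (`|L (e i)| ^+ 2)%:E)%E \is a fin_num.
  rewrite ge0_fin_numE; first exact: le_lt_trans esumV (ltry _).
  by apply: esum_ge0 => i _; rewrite lee_fin sqr_ge0.
rewrite sqr_sqrtr; last by rewrite fine_ge0// esum_ge0// => i _; rewrite lee_fin sqr_ge0.
apply: (@le_cvg _ _ (@totally I) _ T (fun=> fine (\esum_(i in D) (`|L (e i)| ^+ 2)%:E))).
- exact: TV.
- exact: cvg_cst.
- by apply: nearW => F; rewrite -lee_fin fineK// esumT.
Qed.

End HilbertSchmidt.

(** * Extremal properties of ordered eigenvalues *)

Section OrderedEigenvalues.
Context {R : realType} {H : completeNormedModType R} {ip : {dot H for idfun}}.
Hypothesis ipn : induces_norm ip.
Context {A : {linear H -> H}} (A_compact : compact_operator A).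
Variable S : eigensystem ip A.

Lemma cvg_compact_operator T (F : set_system T) {FF : Filter F} (f : T -> H) x :
  f @ F --> x -> (fun t => A (f t)) @ F --> A x.
Proof.
have [C C0 AC] := compact_operator_bounded A_compact.
move/cvgrPdist_le => fx; apply/cvgrPdist_le => eps eps0.
have C1 : 0 < C + 1 by rewrite ltr_wpDl.
have := fx _ (divr_gt0 eps0 C1); apply: filterS => t h.
rewrite -linearB (le_trans (AC _))// (le_trans (ler_wpM2l C0 h))//.
by rewrite mulrCA ler_piMr ?ltW// ltr_pdivrMr// mul1r ltrDl.
Qed.

Let initial k (j : 'I_k.+1) : eidx S (inl k) -> eidx S (inl (j : nat)).
Proof. by apply: eidx_initial; rewrite -ltnS. Qed.

Let psi_ortho k : eidx S (inl k) -> forall i j : 'I_k.+1,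
  setT i -> setT j -> ip (psi S i) (psi S j) = (i == j)%:R.
Proof. by move=> Sk i j _ _; rewrite /psi (evec_basis S).1//; exact: initial. Qed.

Lemma eigenspan_dot k (c : 'I_k.+1 -> R) : eidx S (inl k) ->
  ip (\sum_j c j *: psi S j) (\sum_j c j *: psi S j) = \sum_j c j ^+ 2.
Proof.
by move=> Sk; rewrite [LHS](ip_lincomb (psi_ortho Sk)) ?index_enum_uniq.
Qed.

Lemma eigenspan_ge k (c : 'I_k.+1 -> R) : eidx S (inl k) ->
  lam S k * ip (\sum_j c j *: psi S j) (\sum_j c j *: psi S j)
  <= ip (A (\sum_j c j *: psi S j)) (\sum_j c j *: psi S j).
Proof.
move=> Sk; have -> : A (\sum_j c j *: psi S j) = \sum_(j < k.+1) (lam S j * c j) *: psi S j.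
  rewrite linear_sum; apply: eq_bigr => j _.
  by rewrite linearZ/= /psi evec_eigen ?scalerA 1?mulrC//; exact: initial.
rewrite eigenspan_dot// [leRHS](ip_lincomb (psi_ortho Sk)) ?index_enum_uniq//.
rewrite mulr_sumr; apply: ler_sum => j _; rewrite -mulrA -expr2 ler_wpM2r ?sqr_ge0//.
by apply: eigval_noninc => //; rewrite -ltnS.
Qed.

(** Adjoined kernel vectors count as coming after every ordered eigenvalue. *)
Lemma eigval_tail k i : eidx S (inl k) -> eidx S i ->
  (forall j, (j < k)%N -> i <> inl j) -> eigval S i <= lam S k.
Proof.
move=> Sk; case: i => j Sj jk; last by rewrite eigval_adjoined// eigval_ge0.
by apply: eigval_noninc => //; rewrite leqNgt; apply/negP => /jk.
Qed.

(** The inequality is clear for the finite partial sums of the expansion of x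
    and passes to the limit by continuity of A. *)
Lemma eigenspan_orth_le k x : eidx S (inl k) ->
  (forall j, (j < k)%N -> ip (psi S j) x = 0) -> ip (A x) x <= lam S k * ip x x.
Proof.
move=> Sk xk.
pose f (F : {fset (nat + nat)}) := \sum_(i <- F | i \in eidx S) tensor ip (evec S i) (evec S i) x.
have fx : f @ totally --> x by exact: (evec_basis S).2.
have Af := cvg_compact_operator fx.
have h1 : (fun F => ip (A (f F)) (f F)) @ totally --> ip (A x) x.
  by apply: (cvg_ip ipn); [exact: Af|exact: fx].
have h2 : (fun F => lam S k * ip (f F) (f F)) @ totally --> lam S k * ip x x.
  by apply: cvgMl_tmp; apply: (cvg_ip ipn); exact: fx.
apply: (le_cvg h1 h2); apply: nearW => F.
rewrite /f -big_filter; set s := [seq i <- F | i \in eidx S].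
have us : uniq s by rewrite filter_uniq// fset_uniq.
have sS i : i \in s -> eidx S i by rewrite mem_filter => /andP[/set_mem].
rewrite /tensor eigen_lincomb// !(ip_lincomb (evec_basis S).1)// mulr_sumr.
rewrite big_seq [leRHS]big_seq; apply: ler_sum => i /sS Si.
rewrite -mulrA -expr2.
have [[j jk ij]|ij] := pselect (exists2 j, (j < k)%N & i = inl j).
  by rewrite ij xk// expr0n/= !mulr0.
rewrite ler_wpM2r ?sqr_ge0//; apply: eigval_tail => // j jk ije.
by apply: ij; exists j.
Qed.

End OrderedEigenvalues.

(** * Comparison with the compressions to the block *)

Lemma sum_sorted (V : zmodType) (J : {fset nat}) (F : nat -> V) :
  \sum_(k <- J) F k
  = \sum_(i < size (sort leq (enum_fset J))) F (nth 0%N (sort leq (enum_fset J)) i).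
Proof.
set s := sort leq _.
rewrite -(big_mkord xpredT (fun i => F (nth 0%N s i))) -(big_nth 0%N xpredT F).
by apply: perm_big; rewrite perm_sym perm_sort.
Qed.

Section Comparison.
Context {R : realType} {H : completeNormedModType R} {ip : {dot H for idfun}}.
Hypothesis ipn : induces_norm ip.
Context {A : {linear H -> H}} (Ah : {linear H -> H}).
Hypotheses (A_compact : compact_operator A) (Ah_compact : compact_operator Ah).
Hypotheses (A_sa : self_adjoint ip A) (Ah_sa : self_adjoint ip Ah).
Variables (S : eigensystem ip A) (Sh : eigensystem ip Ah) (J : {fset nat}).
Hypothesis J_neq0 : J != fset0.
Hypothesis J_S : forall k, k \in J -> eidx S (inl k).
Hypothesis J_Sh : forall k, k \in J -> eidx Sh (inl k).
Hypothesis gap_gt0 : 0 < gap S J.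
Hypothesis alpha_le : alpha S J Ah <= 1 / 4.

Local Notation E := (Ah \- A).
Local Notation Rs := (abs_resolvent_sqrt S J).
Local Notation out := (outside S J).
Local Notation s := (sort leq (enum_fset J)).
Local Notation d := (size s).
Local Notation kk i := (nth 0%N s i).

Let mem_s k : (k \in s) = (k \in J). Proof. by rewrite mem_sort. Qed.

Let s_uniq : uniq s. Proof. by rewrite sort_uniq fset_uniq. Qed.

Let kkJ i : (i < d)%N -> kk i \in J.
Proof. by move=> id; rewrite -mem_s mem_nth. Qed.

Let kk_lt i j : (i < j)%N -> (j < d)%N -> (kk i < kk j)%N.
Proof.
move=> ij jd; have id := ltn_trans ij jd.
have ss : sorted ltn s by rewrite ltn_sorted_uniq_leq s_uniq sort_sorted//; exact: leq_total.
by apply: (sorted_ltn_nth ltn_trans).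
Qed.

Let kk_le i j : (i <= j)%N -> (j < d)%N -> (kk i <= kk j)%N.
Proof.
rewrite leq_eqVlt => /predU1P[->//|ij] jd; exact/ltnW/kk_lt.
Qed.

Let kkS i : (i < d)%N -> eidx S (inl (kk i)).
Proof. by move=> id; exact/J_S/kkJ. Qed.

(** The isometry from coordinate vectors onto the block, with J listed in
    increasing order. *)
Definition blockvec (c : 'rV[R]_d) : H := \sum_(i < d) c 0 i *: psi S (kk i).

Let ortho (i j : 'I_d) : setT i -> setT j -> ip (psi S (kk i)) (psi S (kk j)) = (i == j)%:R.
Proof.
move=> _ _; rewrite /psi (evec_basis S).1; try exact: kkS.
by rewrite (inj_eq (@inl_inj _ _)) nth_uniq.
Qed.

Lemma blockvec_dot c c' : ip (blockvec c) (blockvec c') = dotv c c'.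
Proof. by rewrite dotvE [LHS](ip_lincomb ortho) ?index_enum_uniq. Qed.

Lemma ip_blockvec c (i : 'I_d) : ip (psi S (kk i)) (blockvec c) = c 0 i.
Proof. by rewrite ipC [LHS](ip_lincombl ortho) ?index_enum_uniq// mem_index_enum. Qed.

Lemma blockvec_linear a c c' : blockvec (a *: c + c') = a *: blockvec c + blockvec c'.
Proof.
rewrite /blockvec scaler_sumr -big_split; apply: eq_bigr => i _.
by rewrite !mxE scalerDl scalerA.
Qed.

Lemma blockvec_out c i : out i -> ip (evec S i) (blockvec c) = 0.
Proof.
move=> [Si iJ]; rewrite ip_sumr big1// => j _.
rewrite ipZr (evec_basis S).1//; last exact: kkS.
case: eqP => [ij|_]; last by rewrite mulr0.
by exfalso; apply: iJ; exists (kk j) => //; exact: kkJ.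
Qed.

Lemma block_proj_vec x : block_proj S J x = blockvec (\row_i ip (psi S (kk i)) x).
Proof.
apply: (eq_from_coords (evec_basis S)) => j Sj.
rewrite ip_block_proj//; case: ifPn => jo.
  by rewrite blockvec_out//; exact/set_mem.
have [k kJ ->] : exists2 k, k \in J & j = inl k.
  move: Sj jo; case: j => k Sk; first by rewrite outside_inl// negbK; exists k.
  by move=> /negP h; exfalso; apply: h; apply/mem_set; split => // -[].
have id : (index k s < d)%N by rewrite index_mem mem_s.
have -> : k = kk (Ordinal id) by rewrite /= nth_index ?mem_s.
by rewrite [RHS]ip_blockvec mxE.
Qed.

(** In the basis psi_k, the matrices N+ (sg = 1) and N- (sg = -1) of the block
    parts of the two operators between which [block_form] squeezes Ah. *)
Definition compression (sg : R) : 'M[R]_d := \matrix_(i, j)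
  (ip (Ah (psi S (kk i))) (psi S (kk j))
   + sg * (2 * ip (Rs (E (psi S (kk i)))) (Rs (E (psi S (kk j)))))).

Lemma compression_sym sg : (compression sg)^T = compression sg.
Proof.
apply/matrixP => i j; rewrite !mxE Ah_sa (ipC ip (psi S (kk j))); congr (_ + _ * (_ * _)).
exact: ipC.
Qed.

Lemma compression_form sg c : dotv (c *m compression sg) c =
  ip (Ah (blockvec c)) (blockvec c)
  + sg * (2 * ip (Rs (E (blockvec c))) (Rs (E (blockvec c)))).
Proof.
have -> : Rs (E (blockvec c)) = \sum_(i < d) c 0 i *: Rs (E (psi S (kk i))).
  apply: (linear_lincomb (f := fun x => Rs (E x))) => b y z.
  exact: resolvent_diff_linear.
have -> : Ah (blockvec c) = \sum_(i < d) c 0 i *: Ah (psi S (kk i)).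
  by apply: linear_lincomb => *; rewrite linearP.
rewrite dotvE /blockvec !ip_sumr !mulr_sumr -big_split; apply: eq_bigr => j _ /=.
rewrite mxE !ipZr !ip_suml mulr_suml !mulr_sumr -big_split; apply: eq_bigr => i _ /=.
by rewrite mxE !ipZl; ring.
Qed.

Lemma compression_trace sg : \tr (compression sg)
  = \sum_(k <- J) ip (Ah (psi S k)) (psi S k)
    + sg * (2 * \sum_(k <- J) ip (Rs (E (psi S k))) (Rs (E (psi S k)))).
Proof.
rewrite !mulr_sumr -big_split sum_sorted.
by apply: eq_bigr => i _; rewrite mxE.
Qed.

Lemma blockvec_form_le c :
  `|ip (Ah (blockvec c)) (blockvec c) - \sum_(i < d) lam S (kk i) * c 0 i ^+ 2|
  <= gap S J / 4 * dotv c c.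
Proof.
have := block_part_form_le ipn J_neq0 J_S gap_gt0 A_compact Ah_compact alpha_le (blockvec_out c).
rewrite blockvec_dot sum_sorted; under eq_bigr do rewrite ip_blockvec.
exact.
Qed.

Let dotv_gt0 (c : 'rV[R]_d) : c != 0 -> 0 < dotv c c.
Proof. by move=> c0; rewrite lt_neqAle eq_sym dotv_eq0 c0 dotv_ge0. Qed.

(** Some combination x of the first i + 1 block eigenvectors is orthogonal to the
    first i eigenvectors of N+.  On x the form of A is at least lam_(k_i), that of
    E at least -gap / 4, the correction is nonnegative, and N+ is at most mu_i. *)
Lemma compression_eig_ge u mu i : diagonalization (compression 1) u mu -> (i < d)%N ->
  lam S (kk i) - gap S J / 4 <= mu i.
Proof.
move=> [uu uN umax _] id.
pose emb (j : 'I_i.+1) : 'I_d := widen_ord id j.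
have [|c [j0 cj0] cu] := @exists_combination_killed R 'rV[R]_d i
    (fun j => delta_mx 0 (emb j)) (fun j => dotv (u j)).
  by move=> j b x y; rewrite dotvDr dotvZr.
set x := \sum_j _ in cu.
have xE l : x 0 l = \sum_(j < i.+1) c j * (l == emb j)%:R.
  by rewrite summxE; apply: eq_bigr => j _; rewrite !mxE eqxx.
have x0 : x != 0.
  apply: contra_neq cj0 => x0; move: (xE (emb j0)); rewrite x0 mxE.
  rewrite (bigD1 j0)//= eqxx mulr1 big1 ?addr0// => j jj0.
  rewrite (_ : _ == _ = false) ?mulr0//; apply: contra_neqF jj0 => /eqP[jj].
  by apply/val_inj; rewrite /= jj.
have xi (l : 'I_d) : (i < l)%N -> x 0 l = 0.
  move=> il; rewrite xE big1// => j _.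
  rewrite (_ : _ == _ = false) ?mulr0//; apply/eqP => /(congr1 val)/= lj.
  by have := ltn_ord j; rewrite -lj ltnS leqNgt il.
have h1 := umax i id x (fun j ji => cu (Ordinal ji)).
have h2 := blockvec_form_le x.
rewrite compression_form in h1.
have h3 : lam S (kk i) * dotv x x <= \sum_(i < d) lam S (kk i) * x 0 i ^+ 2.
  rewrite dotvE mulr_sumr; apply: ler_sum => l _; rewrite -expr2.
  have [li|il] := leqP l i; last by rewrite xi// expr0n/= !mulr0.
  by rewrite ler_wpM2r ?sqr_ge0//; apply: eigval_noninc; [exact: kk_le|exact: kkS].
have h4 := ip_ge0 ip (Rs (E (blockvec x))).
rewrite -(ler_pM2r (dotv_gt0 x0)); move: h2; rewrite ler_norml => /andP[]; lra.
Qed.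

(** Dual to [compression_eig_ge]: some combination of the first i + 1 eigenvectors
    of N- has no component on the first i block eigenvectors. *)
Lemma compression_eig_le u mu i : diagonalization (compression (-1)) u mu -> (i < d)%N ->
  mu i <= lam S (kk i) + gap S J / 4.
Proof.
move=> diag id.
have [|c [j0 cj0] cu] := @exists_combination_killed R 'rV[R]_d i
    (fun j => u j) (fun j x => x 0 (widen_ord (ltnW id) j)).
  by move=> j b x y; rewrite !mxE.
set x := \sum_j _ in cu.
pose c' j := if insub j is Some o then c o else 0.
have c'E (j : 'I_i.+1) : c' j = c j by rewrite /c' valK.
have xE : x = \sum_(j <- index_iota 0 i.+1) c' j *: u j.
  rewrite big_mkord; by apply: eq_bigr => j _; rewrite c'E.
have [] := @diagonalization_span _ _ _ u mu i (index_iota 0 i.+1) c' diag id (iota_uniq _ _).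
  by move=> j; rewrite mem_index_iota.
rewrite -xE => xx h1.
have xpos : 0 < dotv x x.
  rewrite xx big_mkord lt_neqAle sumr_ge0 ?andbT => [|j _]; last exact: sqr_ge0.
  rewrite eq_sym psumr_neq0 => [|j _]; last exact: sqr_ge0.
  apply/hasP; exists j0; rewrite ?mem_index_enum//=.
  by rewrite lt_neqAle sqr_ge0 andbT eq_sym sqrf_eq0 c'E.
have xi (l : 'I_d) : (l < i)%N -> x 0 l = 0.
  by move=> li; rewrite -[RHS](cu (Ordinal li)); congr (x 0 _); exact: val_inj.
have h2 := blockvec_form_le x.
rewrite compression_form in h1.
have h3 : \sum_(i < d) lam S (kk i) * x 0 i ^+ 2 <= lam S (kk i) * dotv x x.
  rewrite dotvE mulr_sumr; apply: ler_sum => l _; rewrite -expr2.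
  have [il|li] := leqP i l; last by rewrite xi// expr0n/= !mulr0.
  by rewrite ler_wpM2r ?sqr_ge0//; apply: eigval_noninc; [exact: kk_le|exact: kkS].
have h4 := ip_ge0 ip (Rs (E (blockvec x))).
rewrite -(ler_pM2r xpos); move: h2; rewrite ler_norml => /andP[]; lra.
Qed.

(** An outside eigenvalue below lam_k stays below lam_k - gap / 4 when raised by
    3/4 g, because g is at most its distance to lam_k and at least gap. *)
Lemma tail_gap k i : k \in J -> out i -> (forall l, (l < k)%N -> i <> inl l) ->
  eigval S i + 3 / 4 * gdist S J i <= lam S k - gap S J / 4.
Proof.
move=> kJ oi ik; have lt := eigval_tail (J_S kJ) oi.1 ik.
have h1 := gap_le_gdist J_neq0 oi; have := dist_block_le S (eigval S i) kJ.
rewrite -/(gdist S J i) distrC ger0_norm ?subr_ge0//; lra.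
Qed.

Lemma head_gap k l : k \in J -> (l < k)%N -> l \notin J ->
  lam S k + gap S J / 4 <= lam S l - 3 / 4 * gdist S J (inl l).
Proof.
move=> kJ lk lJ; have Sl := eidx_initial (ltnW lk) (J_S kJ).
have oi : out (inl l) by apply: set_mem; rewrite outside_inl.
have le : lam S k <= lam S l by apply: eigval_noninc; [exact: ltnW|exact: J_S].
have h1 := gap_le_gdist J_neq0 oi; have := dist_block_le S (lam S l) kJ.
rewrite -/(gdist S J (inl l)) ger0_norm ?subr_ge0//; lra.
Qed.

(** When u diagonalizes a compression, these are eigenvectors of the corresponding
    block diagonal operator, orthonormal and indexed by the same positions as the
    eigenvectors of A that they are compared with. *)
Definition adapted (u : nat -> 'rV[R]_d) (l : nat) : H :=
  if l \in J then blockvec (u (index l s)) else psi S l.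

Let adapted_kk u j : (j < d)%N -> adapted u (kk j) = blockvec (u j).
Proof. by move=> jd; rewrite /adapted kkJ// index_uniq. Qed.

(** Courant-Fischer with k = k_i: some x in the span of the first k + 1
    eigenvectors of Ah is orthogonal to the first k vectors adapted to N+.  There
    the form of Ah is at least lamhat_k, while the upper bound of [block_form]
    is at most mu_i, by the choice of x on the block and by [tail_gap] outside. *)
Lemma perturbed_eig_le u mu i : diagonalization (compression 1) u mu -> (i < d)%N ->
  lam Sh (kk i) <= mu i.
Proof.
move=> diag id; set k := kk i; have kJ : k \in J by exact: kkJ.
have [|c [j0 cj0] cu] := @exists_combination_killed R H k
    (fun j => psi Sh j) (fun l => ip (adapted u l)).
  by move=> j b x y; rewrite ipDr ipZr.
set x := \sum_j _ in cu.
have xx : ip x x = \sum_j c j ^+ 2 by exact/eigenspan_dot/J_Sh.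
have xpos : 0 < ip x x.
  rewrite xx lt_neqAle sumr_ge0 ?andbT => [|j _]; last exact: sqr_ge0.
  rewrite eq_sym psumr_neq0 => [|j _]; last exact: sqr_ge0.
  apply/hasP; exists j0; rewrite ?mem_index_enum//=.
  by rewrite lt_neqAle sqr_ge0 andbT eq_sym sqrf_eq0.
have h1 : lam Sh k * ip x x <= ip (Ah x) x by exact/eigenspan_ge/J_Sh.
suff h2 : ip (Ah x) x <= mu i * ip x x.
  by rewrite -(ler_pM2r xpos); exact: le_trans h1 h2.
pose c' : 'rV[R]_d := \row_l ip (psi S (kk l)) x.
pose p := block_proj S J x; have pE : p = blockvec c' by exact: block_proj_vec.
have p_out l : out l -> ip (evec S l) p = 0 by rewrite pE; exact: blockvec_out.
have c'u j : (j < i)%N -> dotv (u j) c' = 0.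
  move=> ji; have := cu (Ordinal (kk_lt ji id)).
  rewrite /= adapted_kk ?(ltn_trans ji)// ip_suml => h; rewrite -[RHS]h dotvE.
  by apply: eq_bigr => l _; rewrite ipZl mxE.
have hp : ip (Ah p) p + 2 * ip (Rs (E p)) (Rs (E p)) <= mu i * ip p p.
  have [_ _ umax _] := diag; have := umax i id _ c'u.
  by rewrite compression_form -blockvec_dot -pE mul1r.
have mu_ge := compression_eig_ge diag id.
pose y (F : {fset (nat + nat)}) := \sum_(l <- F | l \in out) ip (evec S l) x *: evec S l.
have yx : y @ totally --> x - p.
  apply: (cvg_expansionB ipn (evec_basis S) (@outside_sub _ _ _ _ _ _)) => j Sj.
  exact: ip_block_proj.
have zx : (fun F => p + y F) @ totally --> x.
  rewrite -[x in X in _ --> X](subrKC p); apply: cvgD; [exact: cvg_cst|exact: yx].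
have Az := cvg_compact_operator Ah_compact zx.
have l1 : (fun F => ip (Ah (p + y F)) (p + y F)) @ totally --> ip (Ah x) x.
  by apply: (cvg_ip ipn); [exact: Az|exact: zx].
have l2 : (fun F => mu i * ip (p + y F) (p + y F)) @ totally --> mu i * ip x x.
  by apply: cvgMl_tmp; apply: (cvg_ip ipn); exact: zx.
apply: (le_cvg l1 l2); apply: nearW => F; rewrite /y -big_filter.
set r := [seq l <- F | l \in out].
have ur : uniq r by rewrite filter_uniq// fset_uniq.
have rout l : l \in r -> out l by rewrite mem_filter => /andP[/set_mem].
have [+ _] := block_form ipn J_neq0 J_S gap_gt0 A_compact Ah_compact A_sa Ah_sa alpha_le
  (fun l => ip (evec S l) x) p_out ur rout.
move=> /le_trans; apply.
set yr := \sum_(l <- r) ip (evec S l) x *: evec S l; have py : ip p yr = 0.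
  rewrite ip_sumr big_seq big1// => l lr.
  by rewrite ipZr [ip p _]ipC p_out ?mulr0//; exact: rout.
have -> : ip (p + yr) (p + yr) = ip p p + \sum_(l <- r) ip (evec S l) x ^+ 2.
  rewrite ipDl !ipDr py [ip yr p]ipC py addr0 add0r; congr (_ + _).
  by rewrite [LHS](ip_lincomb (evec_basis S).1)// => l /rout[].
rewrite mulrDr lerD// mulr_sumr big_seq [leRHS]big_seq; apply: ler_sum => l lr.
have [[l' l'k ll']|nl] := pselect (exists2 l', (l' < k)%N & l = inl l').
  have l'J : l' \notin J.
    have := rout _ lr; rewrite ll' => -[_ h]; apply/negP => l'J.
    by apply: h; exists l'.
  have := cu (Ordinal l'k); rewrite /= /adapted (negbTE l'J) ll' => xl.
  by rewrite -/(psi S l') xl expr0n/= !mulr0.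
rewrite ler_wpM2r ?sqr_ge0//; apply: le_trans mu_ge; apply: tail_gap => //.
  exact: rout.
by move=> l' l'k ll'; apply: nl; exists l'.
Qed.

(** The dual argument: a combination x of the first k + 1 vectors adapted to N-
    that is orthogonal to the first k eigenvectors of Ah.  As x is a finite
    combination of eigenvectors of A, [block_form] applies to it directly. *)
Lemma perturbed_eig_ge u mu i : diagonalization (compression (-1)) u mu -> (i < d)%N ->
  mu i <= lam Sh (kk i).
Proof.
move=> diag id; set k := kk i; have kJ : k \in J by exact: kkJ.
have [|c [j0 cj0] cu] := @exists_combination_killed R H k
    (fun l => adapted u l) (fun j => ip (psi Sh j)).
  by move=> j b x y; rewrite ipDr ipZr.
set x := \sum_j _ in cu.
pose c' j := if insub j is Some o then c o else 0.
have c'E (j : 'I_k.+1) : c' j = c j by rewrite /c' valK.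
pose iJ := [seq l <- index_iota 0 k.+1 | l \in J].
pose iO := [seq l <- index_iota 0 k.+1 | l \notin J].
have splitJ (V : zmodType) (F : nat -> V) : \sum_(l <- index_iota 0 k.+1) F l
    = \sum_(l <- iJ) F l + \sum_(l <- iO) F l.
  by rewrite (bigID [in J])/= !big_filter.
have iJJ l : l \in iJ -> l \in J by rewrite mem_filter => /andP[].
pose z := \sum_(l <- iJ) c' l *: u (index l s).
pose r : seq (nat + nat) := [seq inl l | l <- iO].
pose cr (l : nat + nat) := if l is inl l' then c' l' else 0.
have xE : x = blockvec z + \sum_(l <- r) cr l *: evec S l.
  have -> : x = \sum_(l <- index_iota 0 k.+1) c' l *: adapted u l.
    by rewrite big_mkord; apply: eq_bigr => j _; rewrite c'E.
  rewrite splitJ big_map; congr (_ + _).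
    rewrite /z (linear_lincomb (f := blockvec)); last exact: blockvec_linear.
    by apply: eq_big_seq => l /iJJ lJ; rewrite /adapted lJ.
  by apply: eq_big_seq => l; rewrite mem_filter => /andP[lJ _]; rewrite /adapted (negbTE lJ).
have Sl l : (l \in index_iota 0 k.+1) -> eidx S (inl l).
  by rewrite mem_index_iota/= ltnS => lk; apply: eidx_initial lk (J_S kJ).
have ur : uniq r by rewrite map_inj_uniq ?filter_uniq ?iota_uniq// => a b [].
have rO l : l \in r -> exists l', [/\ l = inl l', l' \notin J & (l' < k)%N].
  move=> /mapP[l' + ->]; rewrite mem_filter mem_index_iota/= ltnS => /andP[lJ lk].
  exists l'; split=> //; rewrite ltn_neqAle lk andbT.
  by apply: contraNneq lJ => ->.
have rout l : l \in r -> out l.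
  move=> /rO[l' [-> lJ lk]]; apply: set_mem; rewrite outside_inl//.
  by apply: Sl; rewrite mem_index_iota/= ltnS ltnW.
(* the block part is a combination of the top eigenvectors of the compression *)
have zE : z = \sum_(j <- [seq index l s | l <- iJ]) c' (kk j) *: u j.
  rewrite big_map; apply: eq_big_seq => l /iJJ lJ.
  by rewrite nth_index// mem_s.
have [] := @diagonalization_span _ _ _ u mu i [seq index l s | l <- iJ]
  (c' \o (fun j => kk j)) diag id.
- rewrite map_inj_in_uniq ?filter_uniq ?iota_uniq// => a b /iJJ aJ /iJJ bJ ab.
  by rewrite -[a](nth_index 0%N (s := s)) ?mem_s// ab nth_index ?mem_s.
- move=> j /mapP[l lJ ->]; move: lJ; rewrite mem_filter mem_index_iota/= ltnS => /andP[lJ lk].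
  rewrite leqNgt; apply/negP => il; have := kk_lt il.
  by rewrite index_mem mem_s lJ nth_index ?mem_s// ltnNge lk => /(_ isT).
rewrite -zE big_map => zz hz.
pose p := blockvec z.
have p_out l : out l -> ip (evec S l) p = 0 by exact: blockvec_out.
set yr := \sum_(l <- r) cr l *: evec S l in xE; have py : ip p yr = 0.
  rewrite ip_sumr big_seq big1// => l lr.
  by rewrite ipZr [ip p _]ipC p_out ?mulr0//; exact: rout.
have xx : ip x x = dotv z z + \sum_(l <- r) cr l ^+ 2.
  rewrite xE ipDl !ipDr py [ip yr _]ipC py addr0 add0r blockvec_dot; congr (_ + _).
  by rewrite [LHS](ip_lincomb (evec_basis S).1)// => l /rout[].
have xpos : 0 < ip x x.
  have -> : ip x x = \sum_(l < k.+1) c l ^+ 2.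
    rewrite xx zz big_map.
    transitivity (\sum_(l <- index_iota 0 k.+1) c' l ^+ 2).
      rewrite splitJ; congr (_ + _).
      by apply: eq_big_seq => l /iJJ lJ /=; rewrite nth_index ?mem_s.
    by rewrite big_mkord; apply: eq_bigr => j _; rewrite c'E.
  rewrite lt_neqAle sumr_ge0 ?andbT => [|j _]; last exact: sqr_ge0.
  rewrite eq_sym psumr_neq0 => [|j _]; last exact: sqr_ge0.
  apply/hasP; exists j0; rewrite ?mem_index_enum//=.
  by rewrite lt_neqAle sqr_ge0 andbT eq_sym sqrf_eq0.
have h1 : ip (Ah x) x <= lam Sh k * ip x x.
  apply: (eigenspan_orth_le ipn Ah_compact (J_Sh kJ)) => j jk.
  exact: (cu (Ordinal jk)).
suff h2 : mu i * ip x x <= ip (Ah x) x.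
  by rewrite -(ler_pM2r xpos); exact: le_trans h2 h1.
have mu_le := compression_eig_le diag id.
have [_] := block_form ipn J_neq0 J_S gap_gt0 A_compact Ah_compact A_sa Ah_sa alpha_le
  cr p_out ur rout.
rewrite -/yr -xE; apply: le_trans.
move: hz; rewrite compression_form mulN1r => hz.
rewrite xx mulrDr lerD// mulr_sumr big_seq [leRHS]big_seq; apply: ler_sum => l lr.
rewrite ler_wpM2r ?sqr_ge0//; have [l' [-> l'J l'k]] := rO _ lr.
by apply: le_trans mu_le _; exact: head_gap.
Qed.

End Comparison.

(** * The bound on the sum of the block eigenvalues *)

Theorem theorem3p12 (R : realType) (H : completeNormedModType R)
    (ip : {dot H for idfun}) (ip_norm : induces_norm ip)
    (H_separable : @separable R H)
    (D : set nat) (e : nat -> H) (e_basis : orthonormal_basis ip D e)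
    (A Ah : {linear H -> H})
    (A_compact : compact_operator A) (Ah_compact : compact_operator Ah)
    (A_sa : self_adjoint ip A) (Ah_sa : self_adjoint ip Ah)
    (A_ge0 : eigenvalues_ge0 A) (Ah_ge0 : eigenvalues_ge0 Ah)
    (S : eigensystem ip A) (Sh : eigensystem ip Ah)
    (J : {fset nat}) (J_neq0 : J != fset0)
    (J_S : forall k, k \in J -> eidx S (inl k))
    (J_Sh : forall k, k \in J -> eidx Sh (inl k))
    (gap_gt0 : 0 < gap S J) :
  alpha S J Ah <= 1 / 4 ->
  `| \sum_(k <- J) lam Sh k - \sum_(k <- J) lam S k
     - \sum_(k <- J) ip ((Ah \- A) (psi S k)) (psi S k) |
  <= (5 / 2 * gap S J + 4 * theta_max S J - 4 * theta_min S J)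
     * beta S J D e Ah ^+ 2.
Proof.
move=> alpha_le; pose v k := abs_resolvent_sqrt S J ((Ah \- A) (psi S k)).
have ortho : {in J &, forall k l, ip (psi S k) (psi S l) = (k == l)%:R}.
  move=> k l kJ lJ; rewrite /psi (evec_basis S).1; try exact: J_S.
  by rewrite (inj_eq (@inl_inj _ _)).
have V_le : \sum_(k <- J) ip (v k) (v k) <= gap S J * beta S J D e Ah ^+ 2.
  have gap_ge0 := ltW gap_gt0.
  rewrite /beta exprMn exprVn sqr_sqrtr// mulVKf ?gt_eqF//.
  have -> : abs_resolvent_sqrt S J \o (Ah \- A) \o block_proj S J
      = (fun x => \sum_(k <- J) ip (psi S k) x *: v k).
    apply/funext => x /=; rewrite -/((Ah \- A) (block_proj S J x)).
    apply: (linear_lincomb (f := fun x => abs_resolvent_sqrt S J ((Ah \- A) x))).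
    by move=> a y z; exact: (resolvent_diff_linear ip_norm).
  exact: (hs_norm_ge ip_norm e_basis (s := J) v (fset_uniq J)).
have AhE : \sum_(k <- J) ip (Ah (psi S k)) (psi S k)
    = \sum_(k <- J) lam S k + \sum_(k <- J) ip ((Ah \- A) (psi S k)) (psi S k).
  rewrite -big_split; apply: eq_big_seq => k kJ /=.
  rewrite ipBl /psi (evec_eigen (J_S _ kJ)) ipZl ortho//.
  by rewrite eqxx mulr1 addrC subrK.
have [u [mu diag]] := symmetric_diagonalization (compression_sym Ah_sa S J 1).
have [u' [nu diag']] := symmetric_diagonalization (compression_sym Ah_sa S J (-1)).
have up : \sum_(k <- J) lam Sh k <= \tr (compression Ah S J 1).
  have [_ _ _ <-] := diag; rewrite sum_sorted; apply: ler_sum => i _.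
  exact: (perturbed_eig_le ip_norm A_compact Ah_compact A_sa Ah_sa
    J_neq0 J_S J_Sh gap_gt0 alpha_le diag).
have lo : \tr (compression Ah S J (-1)) <= \sum_(k <- J) lam Sh k.
  have [_ _ _ <-] := diag'; rewrite sum_sorted; apply: ler_sum => i _.
  exact: (perturbed_eig_ge ip_norm A_compact Ah_compact A_sa Ah_sa
    J_neq0 J_S J_Sh gap_gt0 alpha_le diag').
rewrite compression_trace -/v AhE in up; rewrite compression_trace -/v AhE in lo.
have b0 := sqr_ge0 (beta S J D e Ah).
apply: (@le_trans _ _ (2 * gap S J * beta S J D e Ah ^+ 2)).
  by rewrite ler_norml; apply/andP; split; lra.
rewrite ler_wpM2r//.
have := theta_min_le_max J_neq0 J_S; lra.
Qed.
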